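(* Let $\Pi$ be a Bieberbach group in a Euclidean affine space $\mathcal{E}$ with translation vector space $\mathcal{V}$, with lattice subgroup $L=\Pi\cap\mathcal{V}$ and holonomy group $H$, and suppose that $\mathcal{V}'$ is a nonzero proper $H$-invariant $L$-subspace of $\mathcal{V}$ (so that $\Pi$ is lattice-reducible). Then: (i) The affine subspaces of dimension $\dim\mathcal{V}'$ in $\mathcal{E}$ parallel to $\mathcal{V}'$ are the leaves of a foliation $F_{\mathcal{E}}$ on $\mathcal{E}$, projectable under the covering projections $\mathrm{pr}:\mathcal{E}\to\mathcal{M}=\mathcal{E}/\Pi$ and $\mathcal{E}\to\mathcal{T}=\mathcal{E}/L$ onto foliations $F_{\mathcal{M}}$ of $\mathcal{M}$ and $F_{\mathcal{T}}$ of the torus $\mathcal{T}=\mathcal{E}/L$, both of which have compact totally geodesic leaves, tangent to a parallel distribution. (ii) The leaves $\mathcal{M}'$ of $F_{\mathcal{M}}$ coincide with the $\mathrm{pr}$-images of the leaves $\mathcal{E}'$ of $F_{\mathcal{E}}$, and the restrictions $\mathrm{pr}:\mathcal{E}'\to\mathcal{M}'$ are covering projections. The same remains true if one replaces $\mathcal{M}$ and $\mathrm{pr}$ with $\mathcal{T}$ and the projection $\mathcal{E}\to\mathcal{T}$. Any such $\mathcal{M}'$, being a compact flat Riemannian manifold with Riemannian universal covering $\mathrm{pr}:\mathcal{E}'\to\mathcal{M}'$, corresponds to a Bieberbach group $\Pi'$ in the Euclidean affine space $\mathcal{E}'$ (its deck transformation group, so that $\mathcal{M}'=\mathcal{E}'/\Pi'$).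 If $L'$ and $H'$ denote the lattice subgroup and the holonomy group of $\Pi'$, and $\Sigma'$ is the subgroup of $\Pi$ consisting of all elements of $\Pi$ that map $\mathcal{E}'$ onto itself, then (a) $\Pi'$ consists of the restrictions to $\mathcal{E}'$ of all the elements of $\Sigma'$; (b) $H'$ is formed by the restrictions to $\mathcal{V}'$ of the linear parts of elements of $\Sigma'$; (c) $L'=\Pi'\cap\mathcal{V}'$, and $L\cap\mathcal{V}'\subseteq L'$. (iii) The restriction homomorphism $\Sigma'\to\Pi'$ of (ii)(a) is an isomorphism.
   Context: A Euclidean affine space $\mathcal{E}$ is a finite-dimensional real affine space whose translation vector space $\mathcal{V}$ carries an inner product; $\mathrm{Iso}\,\mathcal{E}$ is its isometry group, and vectors of $\mathcal{V}$ are identified with translations of $\mathcal{E}$. An affine subspace is parallel to a vector subspace $\mathcal{V}'\subseteq\mathcal{V}$ if it is an orbit of the translational action of $\mathcal{V}'$ on $\mathcal{E}$ (a ''coset'' of $\mathcal{V}'$ in $\mathcal{E}$). A Bieberbach group in $\mathcal{E}$ is a torsion-free discrete subgroup $\Pi$ of $\mathrm{Iso}\,\mathcal{E}$ for which there exists a compact fundamental domain (a compact subset of $\mathcal{E}$ intersecting all orbits of $\Pi$). Its lattice subgroup is $L=\Pi\cap\mathcal{V}$ (all translations in $\Pi$), which is a full lattice in $\mathcal{V}$, and its holonomy group $H\subseteq\mathrm{Iso}\,\mathcal{V}\cong\mathrm{O}(n)$ consists of the linear parts of all elements of $\Pi$; $H$ is finite. $\Pi$ acts freely and properly discontinuously on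 $\mathcal{E}$, and $\mathcal{M}=\mathcal{E}/\Pi$ is a compact flat Riemannian manifold; every compact flat Riemannian manifold arises this way, with $\Pi$ as deck transformation group of its Riemannian universal covering. A vector subspace $\mathcal{V}'$ of $\mathcal{V}$ is an $L$-subspace if it is spanned by $L\cap\mathcal{V}'$. The group $\Pi$ is called lattice-reducible if a nonzero proper $H$-invariant $L$-subspace of $\mathcal{V}$ exists. A distribution $D$ on $\mathcal{N}$ is projectable under a mapping $\psi:\mathcal{N}\to\hat{\mathcal{N}}$ onto a distribution $\hat D$ on $\hat{\mathcal{N}}$ if $d\psi_x(D_x)=\hat D_{\psi(x)}$ for all $x\in\mathcal{N}$; projectability of a foliation refers to its tangent distribution. Leaves are maximal connected integral manifolds of the tangent distribution. *)

(* Defs.v *)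
From HB Require Import structures.
From mathcomp Require Import all_boot all_order all_algebra.
From mathcomp Require Import generic_quotient ring.
From mathcomp Require Import all_classical all_reals topology normedtype derive.

Set Implicit Arguments.
Unset Strict Implicit.
Unset Printing Implicit Defensive.

Import Order.TTheory GRing.Theory Num.Theory.
Import numFieldNormedType.Exports.

Local Open Scope classical_set_scope.
Local Open Scope ring_scope.

(** * Euclidean affine spaces *)

Record euclideanSpace (R : realType) := EuclideanSpace {
  dir : vectType R;
  ip : dir -> dir -> R;
  ip_sym : forall u v, ip u v = ip v u;
  ip_linear : forall a u v w, ip (a *: u + v) w = a * ip u w + ip v w;
  ip_pos : forall u, u != 0 -> 0 < ip u u;
  pt : Type;
  pt_inhabited : inhabited pt;
  tr : pt -> dir -> pt;
  vsub : pt -> pt -> dir;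
  trA : forall x u v, tr (tr x u) v = tr x (u + v);
  vsubK : forall x y, tr x (vsub y x) = y;
  trK : forall x v, vsub (tr x v) x = v
}.
Arguments dir {R} e.
Arguments ip {R e}.
Arguments pt {R} e.
Arguments tr {R e}.
Arguments vsub {R e}.

Section AffineFacts.
Context {R : realType} {E : euclideanSpace R}.
Implicit Types (x y z : pt E) (u v w : dir E).

Lemma tr_inj x : injective (tr x).
Proof. by move=> u v /(congr1 (vsub^~ x)); rewrite !trK. Qed.

Lemma tr0 x : tr x 0 = x.
Proof.
have h := vsubK x x; set a := vsub x x in h.
have haa : a + a = a by apply: (@tr_inj x); rewrite -trA h.
suff -> : 0 = a by [].
by apply: (@addrI _ a); rewrite addr0 haa.
Qed.

Lemma vsubxx x : vsub x x = 0.
Proof. by rewrite -{1}(tr0 x) trK. Qed.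

Lemma vsubD x y z : vsub z y + vsub y x = vsub z x.
Proof. by apply: (@tr_inj x); rewrite addrC -trA !vsubK. Qed.

Lemma vsubN x y : vsub x y = - vsub y x.
Proof. by apply/eqP; rewrite -addr_eq0 vsubD vsubxx. Qed.

Lemma vsub_eq0 x y : vsub x y = 0 -> x = y.
Proof. by move=> h; rewrite -(vsubK y x) h tr0. Qed.

Lemma vsub_tr x y v : vsub (tr x v) y = vsub x y + v.
Proof. by rewrite -(vsubD y x) trK addrC. Qed.

Lemma ip_linearr a u v w : ip w (a *: u + v) = a * ip w u + ip w v.
Proof. by rewrite ip_sym ip_linear !(ip_sym w). Qed.

Lemma ip0 u : ip (0 : dir E) u = 0.
Proof. by have := ip_linear 1 0 0 u; rewrite scaler0 add0r mul1r => /eqP;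
  rewrite -subr_eq0 opprD addNKr oppr_eq0 => /eqP. Qed.

Lemma ip_ge0 u : 0 <= ip u u.
Proof.
by have [->|/ip_pos/ltW//] := eqVneq u 0; rewrite ip0.
Qed.

Lemma ipD u v : ip (u + v) (u + v) = ip u u + 2 * ip u v + ip v v.
Proof.
rewrite -[u + v]/(u + v) -{1 2}(scale1r u) ip_linear !ip_linearr.
by rewrite !mul1r (ip_sym v u) mulr2n mulrDl mul1r !addrA.
Qed.

Lemma cauchy_schwarz u v : ip u v <= Num.sqrt (ip u u) * Num.sqrt (ip v v).
Proof.
have [v0|vn0] := eqVneq v 0.
  by rewrite v0 ip_sym ip0 mulr_ge0 ?sqrtr_ge0.
have vv := ip_pos vn0.
have h : 0 <= ip u u * ip v v - ip u v ^+ 2.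
  have := ip_ge0 (- (ip u v / ip v v) *: v + u).
  rewrite ip_linear !ip_linearr (ip_sym v u).
  set b := ip u v; set c := ip v v in vv *; set a := ip u u.
  have -> : - (b / c) * (- (b / c) * c + b) + (- (b / c) * b + a)
            = (a * c - b ^+ 2) / c.
    by field; rewrite gt_eqF.
  by rewrite pmulr_lge0 ?invr_gt0.
have [b0|b0] := leP (ip u v) 0.
  by rewrite (le_trans b0) // mulr_ge0 ?sqrtr_ge0.
rewrite -sqrtrM ?ip_ge0// -[leLHS]gtr0_norm// -sqrtr_sqr ler_wsqrtr//.
by rewrite -subr_ge0.
Qed.

Definition edist x y : R := Num.sqrt (ip (vsub x y) (vsub x y)).

Lemma edistxx x : edist x x = 0.
Proof. by rewrite /edist vsubxx ip0 sqrtr0. Qed.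

Lemma edist_eq0 x y : edist x y = 0 -> x = y.
Proof.
move=> /eqP; rewrite sqrtr_eq0 => h; apply: vsub_eq0; apply/eqP.
by apply: contraTT h => /ip_pos; rewrite ltNge.
Qed.

Lemma edist_sym x y : edist x y = edist y x.
Proof.
rewrite /edist; congr Num.sqrt; rewrite vsubN -scaleN1r -[_ *: _]addr0.
by rewrite ip_linear ip_linearr (ip_sym _ 0) !ip0 !addr0 mulrA mulrNN !mul1r.
Qed.

Lemma edist_triangle y x z : edist x z <= edist x y + edist y z.
Proof.
rewrite /edist -(vsubD z y x); set u := vsub x y; set v := vsub y z.
rewrite -[leRHS]ger0_norm ?addr_ge0 ?sqrtr_ge0// -sqrtr_sqr ler_wsqrtr//.
rewrite sqrrD !sqr_sqrtr ?ip_ge0// ipD lerD2r lerD2l.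
by rewrite -[leRHS]mulr_natl ler_pM2l// cauchy_schwarz.
Qed.

End AffineFacts.

HB.instance Definition _ (R : realType) (E : euclideanSpace R) :=
  gen_eqMixin (pt E).
HB.instance Definition _ (R : realType) (E : euclideanSpace R) :=
  gen_choiceMixin (pt E).
HB.instance Definition _ (R : realType) (E : euclideanSpace R) :=
  isMetric.Build R (pt E) edistxx edist_eq0 edist_sym edist_triangle.

(** * Affine subspaces parallel to a vector subspace *)

Section Subspaces.
Context {R : realType} {E : euclideanSpace R}.
Implicit Types (W : {vspace dir E}) (x : pt E).

Definition parallel_affine W x : set (pt E) :=
  [set tr x v | v in [set` W]].

Let sub_pt W x : Type := {y : pt E | vsub y x \in W}.

Fact sub_tr_subproof W x (y : sub_pt W x) (v : subvs_of W) :
  vsub (tr (sval y) (vsval v)) x \in W.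
Proof. by rewrite vsub_tr rpredD ?subvsP//; exact: svalP y. Qed.

Fact sub_vsub_subproof W x (y z : sub_pt W x) :
  vsub (sval y) (sval z) \in W.
Proof.
by rewrite -(vsubD _ x) (vsubN x) rpredB//; [exact: svalP y | exact: svalP z].
Qed.

Definition sub_tr W x (y : sub_pt W x) v : sub_pt W x :=
  exist (fun y => is_true (vsub y x \in W)) _ (sub_tr_subproof y v).

Definition sub_vsub W x (y z : sub_pt W x) : subvs_of W :=
  Subvs (sub_vsub_subproof y z).

Definition affine_subspace W x : euclideanSpace R.
Proof.
refine (@EuclideanSpace R (subvs_of W) (fun u v => ip (vsval u) (vsval v))
  _ _ _ (sub_pt W x) _ (@sub_tr W x) (@sub_vsub W x) _ _ _).
- by move=> u v; rewrite ip_sym.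
- by move=> a u v w; rewrite linearP ip_linear.
- by move=> u u0; apply: ip_pos; apply: contra u0 => /eqP u0; apply/eqP/val_inj.
- by constructor; exists x; rewrite vsubxx mem0v.
- by move=> y u v; apply: val_inj; rewrite /= trA.
- by move=> y z; apply: val_inj; rewrite /= vsubK.
- by move=> y v; apply: val_inj; rewrite /= trK.
Defined.

Definition sub_incl W x : pt (affine_subspace W x) -> pt E := sval.

Lemma range_sub_incl W x : range (@sub_incl W x) = parallel_affine W x.
Proof.
apply/seteqP; split => [_ [[y yW] _ <-]|_ [v /= vW <-]] /=.
  by exists (vsub y x); rewrite ?vsubK.
have h : vsub (tr x v) x \in W by rewrite trK.
by exists (exist (fun y => is_true (vsub y x \in W)) _ h).
Qed.

End Subspaces.

(** * Groups of isometries *)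

Definition is_isometry (R : realType) (E : euclideanSpace R)
    (g : pt E -> pt E) : Prop :=
  bijective g /\ forall x y, mdist (g x) (g y) = mdist x y.

Record isoGroup (R : realType) (E : euclideanSpace R) := IsoGroup {
  elts : set (pt E -> pt E);
  elts_iso : forall g, elts g -> is_isometry g;
  elts1 : elts id;
  eltsM : forall g h, elts g -> elts h -> elts (g \o h);
  eltsV : forall g, elts g -> exists2 h, elts h & cancel g h /\ cancel h g
}.

Section IsoGroups.
Context {R : realType} {E : euclideanSpace R}.
Implicit Types (G : isoGroup E) (g : pt E -> pt E).

Definition torsion_free G : Prop :=
  forall g n, elts G g -> (0 < n)%N -> iter n g =1 id -> g = id.

Definition discrete_subgroup G : Prop :=
  forall g, elts G g -> exists2 U : set {compact-open, pt E -> pt E},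
    open U & U `&` elts G = [set g].

Definition cocompact G : Prop :=
  exists2 K : set (pt E), compact K &
    forall x, exists2 g, elts G g & K (g x).

Definition bieberbach G : Prop :=
  [/\ torsion_free G, discrete_subgroup G & cocompact G].

(* The translations in [G], as vectors. *)
Definition lattice G : set (dir E) := [set v | elts G (tr^~ v)].

Definition linear_part g (A : 'End(dir E)) : Prop :=
  forall x v, g (tr x v) = tr (g x) (A v).

Definition holonomy G : set 'End(dir E) :=
  [set A | exists2 g, elts G g & linear_part g A].

Definition holonomy_invariant G (W : {vspace dir E}) : Prop :=
  forall A, holonomy G A -> (A @: W <= W)%VS.

Definition lattice_subspace G (W : {vspace dir E}) : Prop :=
  exists2 s : seq (dir E),
    (forall v, v \in s -> lattice G v /\ v \in W) & span s = W.

(* [lattice G], as a group of translations. *)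
Definition translation_subgroup G : isoGroup E.
Proof.
refine (@IsoGroup R E [set g | elts G g /\ exists v, g = tr^~ v] _ _ _ _).
- by move=> g [/elts_iso].
- by split; [exact: elts1 | exists 0; apply/funext => x; rewrite tr0].
- move=> g h [Gg [v gE]] [Gh [w hE]]; split; first exact: eltsM.
  by exists (w + v); apply/funext => x /=; rewrite gE hE trA.
- move=> g [Gg [v gE]]; have [h Gh [gh hg]] := eltsV Gg.
  exists h => //; split=> //; exists (- v); apply/funext => x.
  by rewrite -{1}(tr0 x) -(addNr v) -trA -[tr _ v]/((tr^~ v) _) -gE gh.
Defined.

Definition setwise_stabilizer G (S : set (pt E)) : isoGroup E.
Proof.
refine (@IsoGroup R E [set g | elts G g /\ g @` S = S] _ _ _ _).
- by move=> g [/elts_iso].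
- by split; [exact: elts1 | rewrite image_id].
- move=> g h [Gg gS] [Gh hS]; split; first exact: eltsM.
  by rewrite -image_comp hS gS.
- move=> g [Gg gS]; have [h Gh [gh hg]] := eltsV Gg.
  exists h => //; split=> //; rewrite -{1}gS image_comp.
  by rewrite (_ : h \o g = id) ?image_id//; apply/funext => x /=; rewrite gh.
Defined.

End IsoGroups.

(** * Smooth maps between coordinate spaces *)

Section Smooth.
Context {R : realType}.

Fixpoint Cn_on (m k l : nat) (W : set 'rV[R]_k) (f : 'rV[R]_k -> 'rV[R]_l)
    : Prop :=
  if m is m'.+1 then
    (forall w, W w -> differentiable f w) /\
    (forall u, Cn_on m' W (fun w => 'D_u f w))
  else forall w, W w -> {for w, continuous f}.

Definition smooth_on k l (W : set 'rV[R]_k) (f : 'rV[R]_k -> 'rV[R]_l) :=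
  forall m, Cn_on m W f.

Variable E : euclideanSpace R.

Definition vcoord (v : dir E) : 'rV[R]_(\dim {: dir E}) :=
  passmx.rVof (vbasis {: dir E}) v.
Definition vofcoord (a : 'rV[R]_(\dim {: dir E})) : dir E :=
  passmx.vecof (vbasis {: dir E}) a.

(* Affine coordinates centered at [o], and the inverse chart. *)
Definition acoord (o x : pt E) : 'rV[R]_(\dim {: dir E}) := vcoord (vsub x o).
Definition achart (o : pt E) (a : 'rV[R]_(\dim {: dir E})) : pt E :=
  tr o (vofcoord a).

Definition smooth_map_on k (W : set 'rV[R]_k) (psi : 'rV[R]_k -> pt E) :=
  forall o, smooth_on W (acoord o \o psi).

Definition smooth_field_on (U : set (pt E)) (X : pt E -> dir E) :=
  forall o, smooth_on (achart o @^-1` U) (vcoord \o X \o achart o).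

Definition dmap k (psi : 'rV[R]_k -> pt E) (w u : 'rV[R]_k) : dir E :=
  vofcoord ('d (acoord (psi w) \o psi) w u).

Definition d2map k (psi : 'rV[R]_k -> pt E) (w u1 u2 : 'rV[R]_k) : dir E :=
  vofcoord ('D_u1 (fun w' => 'D_u2 (acoord (psi w) \o psi) w') w).

End Smooth.

(** * Flat manifolds covered by a Euclidean space *)

Section Manifolds.
Context {R : realType}.

(* A flat manifold is given through a local isometry [mproj] from [E] onto it;
   [mdiff x v], for [v] in the tangent space [dir E] of [E] at [x], is the
   differential of [mproj] applied to [v].  Only the two models [euclid_mfd] and
   [quotient_mfd] are used; smoothness, metric and Levi-Civita connection of the
   manifold are those for which [mproj] is a local isometry. *)
Record flatManifold (E : euclideanSpace R) := FlatManifold {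
  mcar : topologicalType;
  mtan : Type;
  mproj : pt E -> mcar;
  mdiff : pt E -> dir E -> mtan
}.

Definition euclid_mfd (E : euclideanSpace R) : flatManifold E :=
  @FlatManifold E (pt E) (pt E * dir E)%type id pair.

Section Quotient.
Local Open Scope quotient_scope.
Context {E : euclideanSpace R}.
Variable G : isoGroup E.

Definition orbit_rel (x y : pt E) : bool :=
  `[< exists2 g, elts G g & g x = y >].

(* [g (tr x v) = tr (g x) w] says that [w] is the image of [v] under the linear
   part of [g]: the tangent bundle of E/G is (E x V)/G. *)
Definition tangent_rel (p q : pt E * dir E) : bool :=
  `[< exists2 g, elts G g & g p.1 = q.1 /\ g (tr p.1 p.2) = tr q.1 q.2 >].

Fact orbit_rel_equiv : equiv_class_of orbit_rel.
Proof.
split=> [x|x y|y x z].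
- by apply/asboolP; exists id => //; exact: elts1.
- by apply/asboolP/asboolP => -[g Gg <-]; have [h Gh [gh _]] := eltsV Gg;
    exists h.
- move=> /asboolP[g Gg <-] /asboolP[h Gh <-]; apply/asboolP.
  by exists (h \o g) => //; exact: eltsM.
Qed.

Fact tangent_rel_equiv : equiv_class_of tangent_rel.
Proof.
split=> [p|p q|q p r].
- by apply/asboolP; exists id => //; exact: elts1.
- by apply/asboolP/asboolP => -[g Gg [g1 g2]]; have [h Gh [gh _]] := eltsV Gg;
    exists h => //; rewrite -g2 -g1 !gh.
- move=> /asboolP[g Gg [g1 g2]] /asboolP[h Gh [h1 h2]]; apply/asboolP.
  by exists (h \o g); [exact: eltsM | rewrite /= g1 g2].
Qed.

Canonical orbit_equiv := EquivRelPack orbit_rel_equiv.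
Canonical tangent_equiv := EquivRelPack tangent_rel_equiv.

Definition orbit_space : topologicalType :=
  quotient_topology {eq_quot orbit_equiv}.

Definition orbit_proj (x : pt E) : orbit_space :=
  \pi_{eq_quot orbit_equiv} x.

Definition quotient_mfd : flatManifold E :=
  @FlatManifold E orbit_space {eq_quot tangent_equiv} orbit_proj
    (fun x v => \pi_{eq_quot tangent_equiv} (x, v)).

End Quotient.

(** * Distributions, foliations and leaves *)

Section Foliations.
Context {E : euclideanSpace R} {N : flatManifold E}.

Definition distribution := mcar N -> set (mtan N).

Implicit Type D : distribution.

Definition smooth_distribution (k : nat) D : Prop :=
  forall x0 : pt E, exists (U : set (pt E)) (X : 'I_k -> pt E -> dir E),
    [/\ open U, U x0, forall i, smooth_field_on U (X i) &
     forall x, U x -> free [tuple X i x | i < k] /\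
       D (mproj N x) = mdiff N x @` [set` span [tuple X i x | i < k]]].

(* Invariance under parallel transport: curves in [N] lift to [E], where
   parallel transport is the identity of [dir E]. *)
Definition parallel_distribution D : Prop :=
  forall x y v, D (mproj N x) (mdiff N x v) -> D (mproj N y) (mdiff N y v).

Section Immersed.
Context {X : topologicalType}.
Variable i : X -> mcar N.

(* [phi] maps the open set [W] homeomorphically onto an open subset of [X], and
   [psi] is an immersion lifting [i \o phi] through [mproj]. *)
Definition local_param k (W : set 'rV[R]_k) (phi : 'rV[R]_k -> X)
    (psi : 'rV[R]_k -> pt E) : Prop :=
  [/\ open W,
      [/\ {in [set` W] &, injective phi},
          forall w, W w -> {for w, continuous phi} &
          forall W', W' `<=` W -> open W' -> open (phi @` W')],
      smooth_map_on W psi,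
      forall w, W w -> injective (dmap psi w) &
      forall w, W w -> i (phi w) = mproj N (psi w)].

(* [i : X -> N] is an injectively immersed [k]-dimensional submanifold with
   tangent distribution [D].  Transition maps between local parametrizations are
   automatically smooth, and so need not be required to be. *)
Definition integral_manifold k D : Prop :=
  injective i /\
  forall p : X, exists W phi psi,
    [/\ @local_param k W phi psi, exists2 w, W w & phi w = p &
     forall w, W w -> D (i (phi w)) = mdiff N (psi w) @` range (dmap psi w)].

(* The second fundamental form, i.e. the normal component of the second
   derivatives, vanishes. *)
Definition totally_geodesic k : Prop :=
  forall W phi psi, @local_param k W phi psi ->
  forall w u1 u2 n, W w -> (forall u, ip (dmap psi w u) n = 0) ->
    ip (d2map psi w u1 u2) n = 0.

End Immersed.

Definition foliation (k : nat) D : Prop :=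
  smooth_distribution k D /\
  forall y : mcar N, exists (X : topologicalType) (i : X -> mcar N),
    integral_manifold i k D /\ range i y.

Definition leaf k D (X : topologicalType) (i : X -> mcar N) : Prop :=
  [/\ integral_manifold i k D, connected [set: X], [set: X] !=set0 &
   forall (Y : topologicalType) (j : Y -> mcar N),
     integral_manifold j k D -> connected [set: Y] ->
     range i `<=` range j -> range j = range i].

Definition leaves k D : set (set (mcar N)) :=
  [set S | exists (X : topologicalType) (i : X -> mcar N),
     leaf k D i /\ range i = S].

End Foliations.
Definition projectable (E E' : euclideanSpace R) (N : flatManifold E)
    (N' : flatManifold E') (f : mcar N -> mcar N') (df : mtan N -> mtan N')
    (D : @distribution E N) (D' : @distribution E' N') : Prop :=
  forall x, df @` D x = D' (f x).

(* [mproj N], as a mapping between manifolds, has the differential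
   [(x, v) |-> mdiff N x v]. *)
Definition projectable_mproj (E : euclideanSpace R) (N : flatManifold E)
    (D : @distribution E (euclid_mfd E)) (D' : @distribution E N) : Prop :=
  projectable (mproj N : mcar (euclid_mfd E) -> mcar N)
    (fun p : mtan (euclid_mfd E) => mdiff N p.1 p.2) D D'.

End Manifolds.
Arguments distribution {R E} N.

(** * Coverings *)

Definition homeomorphism (X Y : topologicalType) (f : X -> Y) : Prop :=
  continuous f /\ exists g, [/\ continuous g, cancel f g & cancel g f].

Definition homeomorphism_on (X Y : topologicalType) (A : set X) (B : set Y)
    (f : X -> Y) : Prop :=
  exists g : Y -> X,
    [/\ {within A, continuous f}, {within B, continuous g},
        forall x, A x -> B (f x) /\ g (f x) = x &
        forall y, B y -> A (g y) /\ f (g y) = y].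

Definition covering (X Y : topologicalType) (p : X -> Y) : Prop :=
  [/\ continuous p, range p = [set: Y] &
   forall y, exists (U : set Y) (I : Type) (S : I -> set X),
     [/\ open U, U y, p @^-1` U = \bigcup_i S i, trivIset [set: I] S &
      forall i, open (S i) /\ homeomorphism_on (S i) U p]].

Definition deck (X Y : topologicalType) (p : X -> Y) : set (X -> X) :=
  [set f | homeomorphism f /\ p \o f = p].

(* The metric of the immersed submanifold [i : X -> N] is the one induced from
   [N]: in a local parametrization [phi] with lift [psi] it is the pullback of
   [ip] under [psi].  Here [phi] is [q] in affine coordinates of [F]. *)
Definition riemannian_covering (R : realType) (E F : euclideanSpace R)
    (N : flatManifold E) (X : topologicalType) (i : X -> mcar N)
    (q : pt F -> X) : Prop :=
  covering q /\
  forall x : pt F, exists (W : set 'rV[R]_(\dim {: dir F})) psi,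
    [/\ W 0, local_param i W (q \o achart x) psi &
     forall w u, W w ->
       ip (dmap psi w u) (dmap psi w u) =
         ip (@vofcoord R F u) (@vofcoord R F u)].

(** * Restrictions to an affine subspace *)

Section Restrictions.
Context {R : realType} {E : euclideanSpace R}.
Variables (W : {vspace dir E}) (x : pt E).

Definition restricts_to (g : pt E -> pt E)
    (f : pt (affine_subspace W x) -> pt (affine_subspace W x)) : Prop :=
  forall y, sub_incl (f y) = g (sub_incl y).

Definition linear_restricts_to (A : 'End(dir E))
    (B : 'End(dir (affine_subspace W x))) : Prop :=
  forall v : subvs_of W, vsval (B v : subvs_of W) = A (vsval v).

End Restrictions.

(* Main.v *)
From HB Require Import structures.
From mathcomp Require Import all_boot all_order all_algebra.
From mathcomp Require Import generic_quotient ring lra.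
From mathcomp Require Import all_classical all_reals topology normedtype derive.
Require Import Defs.

(** Holonomy invariance of [V'] says that the elements of [Pi] permute the
    planes parallel to [V'], so that these planes descend to [M] and to [T].
    The proof is the same for [M] and [T]: it concerns a group [G] of
    isometries that permutes the planes, and a space [N] whose points and
    tangent vectors are the orbits of [G] ([quotient_model]). The space [E]
    itself is the case of the trivial group.

    The group theory is in one property of [G], that it moves each point by at
    least some positive distance ([deck_like]). For a Bieberbach group this is
    [torsion_free_discrete_deck_like]: in a bounded sequence of elements two
    must agree up to a small error on a large ball, as in the Arzela-Ascoli
    theorem, hence coincide by discreteness; applied to the powers of an
    element with a fixed point this gives freeness, and applied to an
    accumulating orbit it gives the rest. A continuous open surjection whose
    fibers are the orbits of such a group ([orbit_map]) is a covering with
    deck transformation group [G], and its target is the orbit space.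

    Let [E'] be a plane. An element of [G] taking one point of [E'] into [E']
    preserves [E'], so two points of [E'] have the same image in [N] exactly
    when they lie in one orbit of the group [Pi'] of restrictions to [E'] of
    the stabilizer of [E'] ([restriction_fiber]). Freeness passes to [Pi'] and
    makes restriction injective; the action is cocompact because lattice
    vectors span [V'] ([restriction_cocompact]). Thus [E'/Pi'] is injectively
    immersed in [N] with the image of [E'] as its range.

    These images are the leaves. A parametrization of an integral manifold,
    lifted to [E], has its derivatives in [V'] and so stays in a plane; hence
    the image plane containing a point is locally constant along the manifold,
    and a connected one lies in the image of a single plane
    ([connected_integral_in_plane]). So the images of planes are the maximal
    ones.

    A leaf is given only as some topological space [X] injected into [N].
    Sending a point of [E'] to the point of [X] over its image gives a map
    [q] from [E'] to [X], and everything claimed about [X] follows once [q] is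
    known to be an orbit map for [Pi'] ([integral_orbit_map]). That it is continuous
    means that the lifted parametrizations of [X] are open maps into [E'],
    which is half of the inverse function theorem ([local_diffeo_open]).
    Finally, any local lift of a leaf stays in a plane, so its first and
    second derivatives lie in [V'], which the first derivatives fill; this is
    total geodesy. *)

Set Implicit Arguments.
Unset Strict Implicit.
Unset Printing Implicit Defensive.

Import Order.TTheory GRing.Theory Num.Theory.
Import numFieldNormedType.Exports.

Local Open Scope classical_set_scope.
Local Open Scope ring_scope.

(** * The metric topology in coordinates *)

Section RowVectors.
Context {R : realType}.

Lemma rV_norm_coord n (a : 'rV[R]_n) j : `|a 0 j| <= `|a|.
Proof.
rewrite [leRHS]/Num.norm /= mx_normrE; apply/bigmax_geP; right => /=.
by exists (0, j).
Qed.

Lemma rV_norm_le n (a : 'rV[R]_n) c :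
  0 <= c -> (forall j, `|a 0 j| <= c) -> `|a| <= c.
Proof.
move=> c0 ac; rewrite [leLHS]/Num.norm /= mx_normrE.
by apply/bigmax_leP; split=> // -[i j] _ /=; rewrite (ord1 i).
Qed.

Lemma mulmx_bounded m n (B : 'M[R]_(m, n)) :
  exists2 C, 0 < C & forall a : 'rV_m, `|a *m B| <= C * `|a|.
Proof.
exists (1 + \sum_j \sum_i `|B i j|).
  by rewrite ltr_pwDl// sumr_ge0// => j _; rewrite sumr_ge0.
move=> a; apply: rV_norm_le => [|j].
  by rewrite mulr_ge0// addr_ge0// sumr_ge0// => j _; rewrite sumr_ge0.
rewrite mxE (le_trans (ler_norm_sum _ _ _))//.
apply: (@le_trans _ _ ((\sum_i `|B i j|) * `|a|)).
  rewrite mulr_suml; apply: ler_sum => i _.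
  by rewrite normrM mulrC ler_wpM2l// rV_norm_coord.
rewrite ler_wpM2r//; apply: ler_wpDl => //.
by rewrite (bigD1 j)//= lerDl sumr_ge0// => k _; rewrite sumr_ge0.
Qed.

Lemma mulmxr_continuous m n (B : 'M[R]_(m, n)) :
  continuous (fun a : 'rV[R]_m => a *m B).
Proof.
have [C C0 hC] := mulmx_bounded B.
move=> a A /nbhs_ballP[e /= e0 h]; apply/nbhs_ballP; exists (e / C) => /=.
  by rewrite divr_gt0.
move=> a'; rewrite mx_norm_ball /ball_ /= => aa; apply: h.
rewrite mx_norm_ball /ball_ /= -mulmxBl (le_lt_trans (hC _))// mulrC.
by rewrite -ltr_pdivlMr.
Qed.

End RowVectors.

Section Metric.
Context {R : realType} {E : euclideanSpace R}.
Implicit Types (x y z : pt E) (u v w : dir E).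

Definition enorm v : R := Num.sqrt (ip v v).

Lemma edistE x y : edist x y = enorm (vsub x y). Proof. by []. Qed.

Lemma enorm_ge0 v : 0 <= enorm v. Proof. exact: sqrtr_ge0. Qed.

Lemma edist_ge0 x y : 0 <= edist x y. Proof. exact: sqrtr_ge0. Qed.

Lemma ip_enorm v : ip v v = enorm v ^+ 2.
Proof. by rewrite sqr_sqrtr// ip_ge0. Qed.

Lemma ipDl u v w : ip (u + v) w = ip u w + ip v w.
Proof. by rewrite -{1}(scale1r u) ip_linear mul1r. Qed.

Lemma ipZl a u w : ip (a *: u) w = a * ip u w.
Proof. by rewrite -[a *: u]addr0 ip_linear ip0 addr0. Qed.

Lemma ipDr u v w : ip w (u + v) = ip w u + ip w v.
Proof. by rewrite !(ip_sym w) ipDl. Qed.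

Lemma ipZr a u w : ip w (a *: u) = a * ip w u.
Proof. by rewrite !(ip_sym w) ipZl. Qed.

Lemma ip_suml (I : Type) (r : seq I) (F : I -> dir E) w :
  ip (\sum_(i <- r) F i) w = \sum_(i <- r) ip (F i) w.
Proof.
elim: r => [|i r IH]; first by rewrite !big_nil ip0.
by rewrite !big_cons ipDl IH.
Qed.

Lemma enormZ a v : enorm (a *: v) = `|a| * enorm v.
Proof.
by rewrite /enorm ipZl ipZr mulrA -expr2 sqrtrM ?sqr_ge0// sqrtr_sqr.
Qed.

Lemma enormN v : enorm (- v) = enorm v.
Proof. by rewrite -scaleN1r enormZ normrN1 mul1r. Qed.

Lemma enorm0 : enorm 0 = 0.
Proof. by rewrite /enorm ip0 sqrtr0. Qed.

Lemma enorm_eq0 v : enorm v = 0 -> v = 0.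
Proof.
move=> /eqP h; apply/eqP; apply: contraTT h => /ip_pos h.
by rewrite sqrtr_eq0 -ltNge.
Qed.

Lemma vsub_tr2 x u v : vsub (tr x u) (tr x v) = u - v.
Proof. by rewrite vsub_tr vsubN trK addrC. Qed.

Lemma vsubB y z o : vsub y o - vsub z o = vsub y z.
Proof. by rewrite -(vsubN o) vsubD. Qed.

Lemma edist_tr x u v : edist (tr x u) (tr x v) = enorm (u - v).
Proof. by rewrite edistE vsub_tr2. Qed.

Lemma enormD u v : enorm (u + v) <= enorm u + enorm v.
Proof.
have [x0] := pt_inhabited E.
have := edist_triangle (tr x0 0) (tr x0 u) (tr x0 (- v) : pt E).
by rewrite !edist_tr subr0 sub0r !opprK.
Qed.

Lemma ip_bound u v : `|ip u v| <= enorm u * enorm v.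
Proof.
rewrite ler_norml cauchy_schwarz andbT lerNl.
have := cauchy_schwarz (- u) v.
by rewrite -/(enorm _) -/(enorm v) enormN -scaleN1r ipZl mulN1r.
Qed.

Lemma nbhs_ptP x (A : set (pt E)) :
  nbhs x A <-> exists2 e, 0 < e & forall y, edist x y < e -> A y.
Proof.
split=> [/nbhs_ballP[e /= e0 h]|[e e0 h]]; first by exists e.
by apply/nbhs_ballP; exists e.
Qed.

Lemma open_ptP (A : set (pt E)) :
  open A <->
  forall x, A x -> exists2 e, 0 < e & forall y, edist x y < e -> A y.
Proof.
by rewrite openE; split=> h x Ax; [apply/nbhs_ptP; exact: h|apply/nbhs_ptP/h].
Qed.

Lemma open_edist x e : open [set y | edist x y < e].
Proof.
apply/open_ptP => y /= xy; exists (e - edist x y); first by rewrite subr_gt0.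
by move=> z; rewrite ltrBrDl; apply: le_lt_trans; exact: edist_triangle.
Qed.

Local Notation n := (\dim {: dir E}).
Local Notation b := (vbasis {: dir E}).

Lemma vcoordK : cancel (@vcoord R E) (@vofcoord R E).
Proof. exact/passmx.rVofK/vbasisP. Qed.

Lemma vofcoordK : cancel (@vofcoord R E) (@vcoord R E).
Proof. exact/passmx.vecofK/vbasisP. Qed.

Lemma vcoord_linear a u v : vcoord (a *: u + v) = a *: vcoord u + vcoord v.
Proof. exact: passmx.rVof_linear. Qed.

Lemma vofcoord_linear (a : R) (p q : 'rV[R]_n) :
  vofcoord (a *: p + q) = a *: vofcoord p + vofcoord q :> dir E.
Proof. exact: passmx.vecof_linear. Qed.

HB.instance Definition _ := GRing.isLinear.Build R (dir E) 'rV[R]_n _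
  (@vcoord R E) vcoord_linear.
HB.instance Definition _ := GRing.isLinear.Build R 'rV[R]_n (dir E) _
  (@vofcoord R E) vofcoord_linear.

Lemma vofcoord_bounded :
  exists2 C, 0 < C & forall a : 'rV[R]_n, enorm (vofcoord a : dir E) <= C * `|a|.
Proof.
exists (1 + \sum_(i < n) enorm b`_i).
  by rewrite ltr_pwDl// sumr_ge0// => i _; exact: enorm_ge0.
move=> a; apply: (@le_trans _ _ (\sum_(i < n) enorm (a 0 i *: b`_i))).
  rewrite /vofcoord /passmx.vecof; elim/big_rec2: _ => [|i y z _ h].
    by rewrite enorm0.
  by rewrite (le_trans (enormD _ _))// lerD2l.
rewrite mulrDl mul1r ler_wpDl// mulr_suml ler_sum// => i _.
by rewrite enormZ mulrC ler_wpM2l ?enorm_ge0// rV_norm_coord.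
Qed.

(** The coordinates of a vector are recovered from its inner products with the
    basis by inverting the Gram matrix, which is nonsingular since the inner
    product is definite; so they are bounded by the norm, and [E] carries the
    topology of its coordinate space. *)
Lemma vcoord_bounded :
  exists2 C, 0 < C & forall v : dir E, `|vcoord v| <= C * enorm v.
Proof.
pose G := (\matrix_(i, j) ip (b`_i : dir E) b`_j : 'M[R]_n).
have GE (a : 'rV[R]_n) j : (a *m G) 0 j = ip (vofcoord a : dir E) b`_j.
  rewrite mxE /vofcoord /passmx.vecof ip_suml; apply: eq_bigr => i _.
  by rewrite mxE ipZl.
have Gu : G \in unitmx.
  rewrite -row_free_unit; apply/row_freeP/row_freeP.
  rewrite -kermx_eq0; apply/rowV0P => a /sub_kermxP aG.
  apply: (can_inj vofcoordK); rewrite linear0.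
  apply/eqP/negPn/negP => /ip_pos.
  rewrite {1}/vofcoord /passmx.vecof ip_suml big1 ?ltxx// => i _.
  by rewrite ipZl ip_sym -GE aG mxE mulr0.
have [C C0 hC] := mulmx_bounded (invmx G).
exists (C * (1 + \sum_(i < n) enorm b`_i)).
  by rewrite mulr_gt0// ltr_pwDl// sumr_ge0// => i _; exact: enorm_ge0.
move=> v; rewrite -[vcoord v](mulmxK Gu) (le_trans (hC _))// -mulrA.
rewrite ler_pM2l//; apply: rV_norm_le => [|j].
  by rewrite mulr_ge0 ?enorm_ge0// addr_ge0// sumr_ge0// => i _; exact: enorm_ge0.
rewrite GE vcoordK (le_trans (ip_bound _ _))// mulrC ler_wpM2r ?enorm_ge0//.
rewrite ler_wpDl// (bigD1 j)//= lerDl sumr_ge0// => k _; exact: enorm_ge0.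
Qed.

Lemma achartK o : cancel (@achart R E o) (@acoord R E o).
Proof. by move=> a; rewrite /acoord /achart trK vofcoordK. Qed.

Lemma acoordK o : cancel (@acoord R E o) (@achart R E o).
Proof. by move=> x; rewrite /acoord /achart vcoordK vsubK. Qed.

Lemma achart0 o : @achart R E o 0 = o.
Proof. by rewrite /achart linear0 tr0. Qed.

Lemma achart_continuous o : continuous (@achart R E o).
Proof.
have [C C0 hC] := vofcoord_bounded.
move=> a A /nbhs_ptP[e e0 h]; apply/nbhs_ballP; exists (e / C) => /=.
  by rewrite divr_gt0.
move=> a'; rewrite mx_norm_ball /ball_ /= => aa; apply: h.
rewrite /achart edist_tr -linearB (le_lt_trans (hC _))// mulrC.
by rewrite -ltr_pdivlMr.
Qed.

Lemma acoord_continuous o : continuous (@acoord R E o).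
Proof.
have [C C0 hC] := vcoord_bounded.
move=> x A /nbhs_ballP[e /= e0 h]; apply/nbhs_ptP; exists (e / C).
  by rewrite divr_gt0.
move=> y xy; apply: h; rewrite mx_norm_ball /ball_ /= -linearB /=.
rewrite (vsubN y) opprK vsubD (le_lt_trans (hC _))// mulrC.
by rewrite -ltr_pdivlMr.
Qed.

End Metric.

(** * Isometries and discrete groups *)

Section Isometries.
Context {R : realType} {E : euclideanSpace R}.
Implicit Types (x y z : pt E) (u v w : dir E) (g : pt E -> pt E).

Lemma isometry_edist g x y : is_isometry g -> edist (g x) (g y) = edist x y.
Proof. by move=> [_]; exact. Qed.

Lemma ip_polarization u v :
  ip u v = (enorm u ^+ 2 + enorm v ^+ 2 - enorm (u - v) ^+ 2) / 2.
Proof.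
rewrite -!ip_enorm -(scaleN1r v) ipD !(ipZl, ipZr).
by field.
Qed.

(** The map [f] induced on vectors preserves inner products, by polarization.
    So the norm of [f (a *: u + v) - a *: f u - f v] is that of the same
    expression without [f], which vanishes. *)
Lemma isometry_linear_part g : is_isometry g -> exists A, linear_part g A.
Proof.
move=> gI; have [x0] := pt_inhabited E.
pose f v := vsub (g (tr x0 v)) (g x0).
have fE v : g (tr x0 v) = tr (g x0) (f v) by rewrite /f vsubK.
have fB u v : enorm (f u - f v) = enorm (u - v).
  by rewrite -(edist_tr (g x0)) -!fE isometry_edist// edist_tr.
have f0 : f 0 = 0 by rewrite /f tr0 vsubxx.
have fn u : enorm (f u) = enorm u by have := fB u 0; rewrite f0 !subr0.
have fip u v : ip (f u) (f v) = ip u v by rewrite !ip_polarization !fn fB.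
have flin (a : R) u v : f (a *: u + v) = a *: f u + f v.
  set w := a *: u + v; apply/eqP; rewrite -subr_eq0; apply/eqP.
  apply: enorm_eq0; rewrite /enorm -scaleN1r.
  rewrite !(ipDl, ipDr, ipZl, ipZr) !fip.
  by rewrite /w !(ipDl, ipDr, ipZl, ipZr) -[RHS]sqrtr0; congr Num.sqrt; ring.
pose fL : {linear dir E -> dir E} :=
  HB.pack f (GRing.isLinear.Build R (dir E) (dir E) _ f flin).
exists (linfun fL) => x v; rewrite lfunE /= -(vsubK x0 x); set u := vsub x x0.
rewrite trA !fE trA; congr tr.
by have := flin 1 u v; rewrite !scale1r.
Qed.

Lemma isometry_continuous g : is_isometry g -> continuous g.
Proof.
move=> gI x A /nbhs_ptP[e e0 h]; apply/nbhs_ptP; exists e => // y xy.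
by apply: h; rewrite isometry_edist.
Qed.

End Isometries.

Section Discreteness.
Context {R : realType} {E : euclideanSpace R}.
Implicit Types (x y z : pt E) (G : isoGroup E) (g : pt E -> pt E).

Lemma achart_ball_compact x (M : R) :
  compact (@achart R E x @` [set a | `|a| <= M]).
Proof.
apply: continuous_compact; first exact/continuous_subspaceT/achart_continuous.
apply: bounded_closed_compact.
  exists M; split; first exact: num_real.
  by move=> N MN a /= /le_trans->//; exact: ltW.
rewrite (_ : [set _ | _] = (fun a : 'rV[R]_(\dim {:dir E}) => `|a|) @^-1`
  [set r | r <= M])//.
apply: closed_comp => [a _|]; [exact: norm_continuous | exact: closed_le].
Qed.

Lemma ball_net x r e : 0 < e ->
  exists s : seq (pt E),
    forall y, edist x y < r -> exists2 z, z \in s & edist z y < e.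
Proof.
move=> e0; have [C C0 hC] := @vcoord_bounded R E.
have /compact_near_coveringP cK := @achart_ball_compact x (C * r).
pose F := filter_from setT
  (fun s : seq (pt E) => [set s' : seq (pt E) | {subset s <= s'}]).
have FF : Filter F.
  apply: filter_from_filter; first by exists [::].
  move=> s s' _ _; exists (s ++ s') => // t /= ht.
  by split=> z zs; apply: ht; rewrite mem_cat zs ?orbT.
have [y _|s _ hs] := cK _ F (fun s y => exists2 z, z \in s & edist z y < e) FF.
  exists ([set y' | edist y y' < e], [set s : seq (pt E) | y \in s]) => /=.
    split; first by apply/nbhs_ptP; exists e.
    by exists [:: y] => // s; apply; rewrite mem_seq1.
  by move=> [y' s] /= [yy' ys]; exists y.
exists s => y xy; apply: hs => //.
exists (acoord x y); last by rewrite acoordK.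
rewrite /= (le_trans (hC _))// ler_pM2l// -edistE edist_sym; exact: ltW.
Qed.

Lemma compact_margin (K O : set (pt E)) : compact K -> open O -> K `<=` O ->
  exists2 e, 0 < e & forall x y, K x -> edist x y < e -> O y.
Proof.
move=> /compact_near_coveringP cK /open_ptP oO KO.
have /(_ _ (0^'+) (fun e x => forall y, edist x y < e -> O y)) := cK.
case=> [x Kx|d /= d0 hd].
- have [e e0 he] := oO x (KO x Kx); near=> x' e'.
  have e'e : e' <= e / 2 by near: e'; apply: nbhs_right_le; exact: divr_gt0.
  move=> y x'y; apply: he.
  rewrite (le_lt_trans (edist_triangle x' _ _))// (splitr e) ltrD//.
    by near: x'; apply/nbhs_ptP; exists (e / 2) => //; rewrite divr_gt0.
  exact: lt_le_trans x'y e'e.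
- exists (d / 2); first by rewrite divr_gt0.
  move=> x y Kx; apply: hd => //=; last by rewrite divr_gt0.
  rewrite sub0r normrN gtr0_norm ?divr_gt0// ltr_pdivrMr// ltr_pMr//.
  by rewrite ltr1n.
Unshelve. all: by end_near. Qed.

Lemma compact_bounded (K : set (pt E)) x : compact K ->
  exists r, forall y, K y -> edist x y < r.
Proof.
move=> /compact_near_coveringP cK.
have /(_ _ (pinfty_nbhs R) (fun r y => edist x y < r)) := cK.
case=> [y Ky|M [_ hM]].
- near=> y' r.
  have yy' : edist y y' < 1 by near: y'; apply/nbhs_ptP; exists 1.
  have rb : edist x y + 1 < r.
    by near: r; apply: nbhs_pinfty_gt; exact: num_real.
  apply: le_lt_trans rb; rewrite (le_trans (edist_triangle y _ _))// lerD2l.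
  exact: ltW.
- by exists (M + 1) => y Ky; apply: hM => //; rewrite ltrDl.
Unshelve. all: by end_near. Qed.

(** A compact set is bounded and keeps some distance from the complement of
    any open set around it, so closeness to the identity on a ball controls
    compact-open neighborhoods. *)
Lemma compact_open_id (U : set {compact-open, pt E -> pt E}) x0 :
  open U -> U id ->
  exists r e, 0 < e /\
    forall g, (forall x, edist x0 x < r -> edist x (g x) < e) -> U g.
Proof.
move=> oU Uid.
pose B (p : R * R) : set (pt E -> pt E) :=
  [set g | forall x, edist x0 x < p.1 -> edist x (g x) < p.2].
pose F := filter_from [set p : R * R | 0 < p.2] B.
have FF : Filter F.
  apply: filter_from_filter; first by exists (0, 1) => /=.
  move=> [r e] [r' e'] /= e0 e'0; exists (Num.max r r', Num.min e e').
    by rewrite /= lt_min e0.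
  by move=> g gB; split=> x xr /=; have := gB x;
    rewrite /= lt_max lt_min xr ?orbT => /(_ isT)/andP[].
have Fid : F --> (id : {compact-open, pt E -> pt E}).
  apply/compact_open_cvgP => K O cK oO; rewrite image_id => KO.
  have [e e0 he] := compact_margin cK oO KO.
  have [r hr] := compact_bounded x0 cK.
  exists (r, e) => //= g gB _ [x Kx <-]; apply: (he x) => //.
  by apply: gB; exact: hr.
have [[r e] /= e0 h] : F U by apply: Fid; exact: open_nbhs_nbhs.
by exists r, e.
Qed.

Lemma pigeonhole (T : finType) (f : nat -> T) :
  exists n m, (n < m)%N /\ f n = f m.
Proof.
have /injectivePn[i [j ij fij]] : ~~ injectiveb (fun i : 'I_(#|T|.+1) => f i).
  apply/negP => /injectiveP/leq_card; by rewrite card_ord ltnn.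
have : (i < j)%N || (j < i)%N.
  by rewrite -neq_ltn; apply: contra ij => /eqP/val_inj->.
by case/orP => h; [exists i, j | exists j, i].
Qed.

(** The Arzela-Ascoli argument: an isometry is determined, up to a small error
    on a given ball, by the cells of a fine finite net that it sends the
    points of another finite net to. So two members of a bounded sequence of
    isometries agree up to a small error on that ball, and discreteness makes
    them equal. *)
Lemma discrete_bounded_repeat G x0 r (u : nat -> pt E -> pt E) :
  discrete_subgroup G -> (forall n, elts G (u n)) ->
  (forall n, edist x0 (u n x0) < r) ->
  exists n m, (n < m)%N /\ u n = u m.
Proof.
move=> dG Gu hr.
have [U oU UG] := dG id (elts1 G).
have Uid : U id by have [] : (U `&` elts G) id by rewrite UG.
have [r1 [e [e0 he]]] := compact_open_id x0 oU Uid.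
have e40 : 0 < e / 4 by rewrite divr_gt0.
have [s hs] := ball_net x0 r1 e40.
pose r2 := \sum_(z <- s) edist x0 z.
have [s' hs'] := ball_net x0 (r + r2) e40.
(* The points of the net [s] lie within [r2] of [x0], so their images under
   [u n] are in the ball that the net [s'] serves. *)
have hz n (i : 'I_(size s)) :
    exists j : 'I_(size s'),
      edist (tnth (in_tuple s') j) (u n (tnth (in_tuple s) i)) < e / 4.
  set z := tnth _ i.
  have [|z' z's' h] := hs' (u n z).
    rewrite (le_lt_trans (edist_triangle (u n x0) _ _))// ltr_leD//.
    rewrite (isometry_edist _ _ (elts_iso (Gu n))).
    rewrite /r2 (big_tnth _ _ s) (bigD1 i)//=.
    by rewrite lerDl sumr_ge0// => k _; exact: edist_ge0.
  have /tnthP[j zj] : z' \in in_tuple s' by [].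
  by exists j; rewrite -zj.
have /choice[c hc] : forall n, exists c : {ffun 'I_(size s) -> 'I_(size s')},
    forall i,
      edist (tnth (in_tuple s') (c i)) (u n (tnth (in_tuple s) i)) < e / 4.
  move=> n; have /choice[f hf] := hz n.
  by exists [ffun i => f i] => i; rewrite ffunE.
have [n [m [nm cnm]]] := pigeonhole c.
exists n, m; split=> //.
have [h Gh [uh hu]] := eltsV (Gu n).
have : U (h \o u m).
  apply: he => x xr; have [z /(@tnthP _ _ (in_tuple s))[i zi] zx] := hs x xr.
  rewrite -(isometry_edist _ _ (elts_iso (Gu n))) /= hu.
  have := hc n i; have := hc m i; rewrite cnm -zi; set y := tnth _ _ => h1 h2.
  have h3 : edist (u n x) (u n z) < e / 4.
    by rewrite (isometry_edist _ _ (elts_iso (Gu n))) edist_sym.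
  have h4 : edist (u m z) (u m x) < e / 4.
    by rewrite (isometry_edist _ _ (elts_iso (Gu m))).
  have := edist_triangle (u n z) (u n x) (u m x).
  have := edist_triangle y (u n z) (u m x).
  have := edist_triangle (u m z) y (u m x).
  rewrite (edist_sym (u n z) y); lra.
have Ghm : elts G (h \o u m) by exact: eltsM.
move=> Uh; have : (U `&` elts G) (h \o u m) by [].
rewrite UG /= => hE; apply/funext => x.
by rewrite -[RHS]hu -[h (u m x)]/((h \o u m) x) hE.
Qed.

(** The condition includes freeness, on taking [g x = x]; as [G] consists of
    isometries, it also separates the translates of a small ball about [x]. *)
Definition deck_like G := forall x, exists2 e, 0 < e &
  forall g, elts G g -> edist x (g x) < e -> g = id.

Lemma elts_iter G g n : elts G g -> elts G (iter n g).
Proof.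
move=> Gg; elim: n => [|n IH]; first exact: elts1.
exact: (eltsM Gg IH).
Qed.

(** Were an orbit to accumulate at [x], choosing ever closer returns would
    give a sequence contradicting [discrete_bounded_repeat]; it requires
    freeness, which follows from that lemma for the powers of an element
    fixing [x]. *)
Lemma torsion_free_discrete_deck_like G :
  torsion_free G -> discrete_subgroup G -> deck_like G.
Proof.
move=> tG dG.
have free g x : elts G g -> g x = x -> g = id.
  move=> Gg gx.
  have [||n [m [nm nmE]]] := @discrete_bounded_repeat G x 1 (fun n => iter n g) dG.
  - by move=> n; exact: elts_iter.
  - move=> n; suff -> : iter n g x = x by rewrite edistxx.
    by elim: n => //= n ->.
  apply: (tG g (m - n)%N) => //; first by rewrite subn_gt0.
  move=> y; have [[h gh _] _] := elts_iso (elts_iter n Gg).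
  by apply: (can_inj gh); rewrite -iterD subnKC ?(ltnW nm)// nmE.
move=> x; apply: contrapT => hx.
have /choice[f hf] : forall e : R, exists g,
    0 < e -> [/\ elts G g, edist x (g x) < e & 0 < edist x (g x)].
  move=> e; have [e0|] := pselect (0 < e); last by move=> ne; exists id.
  apply: contrapT => hn; apply: hx; exists e => // g Gg ge.
  apply: (free g x Gg); apply: contrapT => gx; apply: hn; exists g => _.
  split=> //; rewrite lt_neqAle edist_ge0 andbT.
  by apply/eqP => /esym/edist_eq0/esym.
(* [f e] returns [x] closer than [e], but not to [x]; feeding back the distance
   reached makes the distances strictly decreasing. *)
pose d := fix d n := if n is m.+1 then edist x (f (d m) x) else (1 : R).
have d0 n : 0 < d n by elim: n => //= n IH; have [] := hf _ IH.
have dS n : d n.+1 < d n by have [] := hf _ (d0 n).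
have dlt n m : (n < m)%N -> d m < d n.
  elim: m => // m IH; rewrite ltnS leq_eqVlt => /orP[/eqP->//|/IH].
  by apply: lt_trans.
have [||n [m [nm nmE]]] := @discrete_bounded_repeat G x 1 (fun n => f (d n)) dG.
- by move=> n; have [] := hf _ (d0 n).
- move=> n; rewrite -[edist _ _]/(d n.+1); exact: (dlt 0%N).
have := dlt n.+1 m.+1 nm; by rewrite /= nmE ltxx.
Qed.

End Discreteness.

(** * Calculus on row vectors *)

Section Calculus.
Context {R : realType}.

Lemma is_diff_elim (V W : normedModType R) (f df : V -> W) x :
  is_diff x f df -> differentiable f x /\ 'd f x = df :> (V -> W).
Proof. by move=> h; split; [exact: ex_diff | exact: diff_val]. Qed.

Lemma mulmx_is_diff m n (B : 'M[R]_(m, n)) (w : 'rV[R]_m) :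
  is_diff w (fun a : 'rV[R]_m => a *m B) (fun a : 'rV[R]_m => a *m B).
Proof.
have cB := @mulmxr_continuous R m n B.
pose F : {linear 'rV[R]_m -> 'rV[R]_n} := mulmxr B.
apply: DiffDef; first exact: (@linear_differentiable _ _ _ F).
exact: (@diff_lin _ _ _ F).
Qed.

Lemma diff_mulmxr k m n (f : 'rV[R]_k -> 'rV[R]_m) (B : 'M[R]_(m, n)) w :
  differentiable f w ->
  is_diff w (fun a => f a *m B) (fun u => 'd f w u *m B).
Proof.
move=> fw; have df := differentiableP fw.
exact: (is_diff_comp df (mulmx_is_diff B (f w))).
Qed.

Lemma derive_mulmxr k m n (f : 'rV[R]_k -> 'rV[R]_m) (B : 'M[R]_(m, n)) w u :
  differentiable f w -> 'D_u (fun a => f a *m B) w = 'D_u f w *m B.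
Proof.
move=> fw; have [dh hE] := is_diff_elim (diff_mulmxr B fw).
by rewrite deriveE// hE deriveE.
Qed.

Lemma derivable_line k (f : 'rV[R]_k -> R) x v t :
  differentiable f (x + t *: v) ->
  is_derive t 1 (fun s => f (x + s *: v)) ('d f (x + t *: v) v).
Proof.
move=> fx.
have lt : is_diff t (fun s : R => x + s *: v) (fun s : R => s *: v).
  apply: is_diff_eq (is_diffD (is_diff_cst x t) (is_diff_scalel t v)) _.
  by rewrite add0r.
have [dh hE] := is_diff_elim (is_diff_comp lt (differentiableP fx)).
apply: DeriveDef; first exact: diff_derivable.
by rewrite deriveE// hE /= scale1r.
Qed.

Lemma differentiable_rV_coord k n (f : 'rV[R]_k -> 'rV[R]_n) w j :
  differentiable f w ->
  is_diff w (fun a => f a 0 j) (fun u => 'd f w u 0 j).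
Proof.
move=> fw; pose B : 'M[R]_(n, 1) := delta_mx j 0.
pose c (M : 'rV[R]_n) : R := M 0 j.
have clin : linear c by move=> a x y; rewrite /c !mxE.
pose cL : {linear 'rV[R]_n -> R} :=
  HB.pack c (GRing.isLinear.Build R 'rV[R]_n R _ c clin).
have cc : continuous cL by exact: coord_continuous.
have dc : is_diff (f w) (cL : 'rV[R]_n -> R) cL.
  apply: DiffDef; first exact: linear_differentiable.
  exact: diff_lin.
exact: (is_diff_comp (differentiableP fw) dc).
Qed.

Lemma rV_ballE n (w a : 'rV[R]_n) e : ball w e a = (`|w - a| < e).
Proof. by rewrite mx_norm_ball. Qed.

Lemma diff0_constant k n (f : 'rV[R]_k -> 'rV[R]_n) w0 e :
  (forall w, ball w0 e w -> differentiable f w /\ forall u, 'd f w u = 0) ->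
  forall w, ball w0 e w -> f w = f w0.
Proof.
move=> hf w w0w; apply/rowP => j.
have inb (t : R) : 0 <= t <= 1 -> ball w0 e (w0 + t *: (w - w0)).
  move=> /andP[t0 t1]; rewrite rV_ballE opprD addNKr normrN normrZ.
  move: w0w; rewrite rV_ballE distrC; apply: le_lt_trans.
  by rewrite ger0_norm// ler_piMl.
pose g (t : R) : R := f (w0 + t *: (w - w0)) 0 j.
have dg (t : R) : 0 <= t <= 1 -> is_derive t 1 g 0.
  move=> /inb/hf[df df0].
  have [dc dcE] := is_diff_elim (differentiable_rV_coord j df).
  by have := derivable_line dc; rewrite dcE df0 mxE.
have [||c _] := @MVT_segment R g (fun=> 0) 0 1 ler01.
- move=> t /[!in_itv]/= /andP[t0 t1]; apply: dg; by rewrite !ltW.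
- apply: derivable_within_continuous => t /[!in_itv]/= /dg[]//.
rewrite mul0r /g scale0r scale1r addr0 [w0 + _]addrC subrK.
by move/eqP; rewrite subr_eq0 => /eqP.
Qed.

(** The supremum norm of row vectors is not differentiable, so distances are
    minimized through the sum of squares. *)
Definition sqnorm n (a : 'rV[R]_n) : R := \sum_j a 0 j ^+ 2.

Lemma sqnorm_ge0 n (a : 'rV[R]_n) : 0 <= sqnorm a.
Proof. by apply: sumr_ge0 => j _; exact: sqr_ge0. Qed.

Lemma sqnorm_ge n (a : 'rV[R]_n) : `|a| ^+ 2 <= sqnorm a.
Proof.
rewrite -[leRHS]sqr_sqrtr ?sqnorm_ge0// lerXn2r ?nnegrE ?sqrtr_ge0//.
apply: rV_norm_le => [|j]; first exact: sqrtr_ge0.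
rewrite -sqrtr_sqr ler_wsqrtr// /sqnorm (bigD1 j)//= lerDl.
by apply: sumr_ge0 => i _; exact: sqr_ge0.
Qed.

Lemma sqnorm_le n (a : 'rV[R]_n) : sqnorm a <= n%:R * `|a| ^+ 2.
Proof.
apply: (@le_trans _ _ (\sum_(j < n) `|a| ^+ 2)).
  apply: ler_sum => j _; rewrite -real_normK ?num_real//.
  by rewrite lerXn2r ?nnegrE// rV_norm_coord.
by rewrite sumr_const card_ord mulr_natl.
Qed.

Lemma sqnorm_continuous n : continuous (@sqnorm n).
Proof.
rewrite /sqnorm; elim: (index_enum _) => [|j s IH] a.
  under eq_fun do rewrite big_nil.
  exact: cst_continuous.
under eq_fun do rewrite big_cons expr2.
have cj : {for a, continuous (fun a : 'rV[R]_n => a 0 j)}.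
  exact: coord_continuous.
exact: (continuousD (continuousM cj cj) (IH a)).
Qed.

Lemma rV_sub_continuous n (c : 'rV[R]_n) : continuous (fun a : 'rV[R]_n => a - c).
Proof.
move=> a; have ca : {for a, continuous (fun a : 'rV[R]_n => a)} by [].
exact: (continuousB ca (@cst_continuous _ _ c a)).
Qed.

(** The sum is half the derivative at zero of the squared distance to [y] along
    the line through [w] in the direction [u], which has a minimum there. *)
Lemma sqnorm_critical k n (f : 'rV[R]_k -> 'rV[R]_n) (y : 'rV[R]_n) w u r :
  0 < r -> (forall a, ball w r a -> differentiable f a) ->
  (forall a, ball w r a -> sqnorm (f w - y) <= sqnorm (f a - y)) ->
  \sum_j (f w - y) 0 j * 'd f w u 0 j = 0.
Proof.
move=> r0 df fmin.
pose s := r / (1 + `|u|).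
have u1 : 0 < 1 + `|u| by rewrite ltr_pwDl.
have s0 : 0 < s by rewrite divr_gt0.
have inb (t : R) : - s < t < s -> ball w r (w + t *: u).
  move=> ts; rewrite rV_ballE opprD addNKr normrN normrZ.
  have {}ts : `|t| < s by rewrite ltr_norml.
  apply: (@le_lt_trans _ _ (`|t| * (1 + `|u|))); first by rewrite ler_wpM2l// lerDr.
  by rewrite -ltr_pdivlMr.
pose h j (t : R) : R := (f (w + t *: u) - y) 0 j.
have dh j (t : R) : - s < t < s -> is_derive t 1 (h j) ('d f (w + t *: u) u 0 j).
  move=> /inb/df fa; have [dc dcE] := is_diff_elim (differentiable_rV_coord j fa).
  have := is_deriveB (derivable_line dc) (is_derive_cst (y 0 j : R) t 1).
  rewrite dcE subr0; congr (is_derive _ _ _ _).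
  by apply/funext => a; rewrite /h !mxE.
pose g := \sum_j (h j ^+ 2).
have gE t : g t = sqnorm (f (w + t *: u) - y).
  by rewrite /g fct_sumE.
pose dgv (t : R) : R := \sum_j 2 * (h j t * 'd f (w + t *: u) u 0 j).
have dg (t : R) : - s < t < s -> is_derive t 1 g (dgv t).
  move=> ts; apply: is_derive_sum => j.
  apply: is_derive_eq (is_deriveX _ (dh j t ts)) _.
  by rewrite expr1 mulrA.
have s00 : - s < 0 < s by rewrite oppr_lt0 s0.
have : is_derive (0 : R) 1 g 0.
  apply: (@derive1_at_min R g (- s) s).
  - by rewrite ltW// gtrN.
  - by move=> t /[!in_itv]/= /dg[]//.
  - by rewrite in_itv.
  - move=> t /[!in_itv]/= ts; rewrite !gE scale0r addr0; apply: fmin.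
    exact: inb.
case=> _ g'0; have [_] := dg 0 s00; rewrite g'0 => /esym.
rewrite /dgv -mulr_sumr => /eqP; rewrite mulf_eq0 pnatr_eq0 /= => /eqP h0.
by rewrite -[RHS]h0; apply: eq_bigr => j _; rewrite /h scale0r addr0.
Qed.

(** The part of the inverse function theorem that leaves need. For [y] near
    [f w0], a point [w1] of a small closed ball about [w0] where [f] comes
    closest to [y] is interior, as [f] moves the boundary of the ball away
    from [f w0]; so it is critical for the distance to [y], and invertibility
    of the differential forces [f w1 = y]. *)
Lemma local_diffeo_open k (f : 'rV[R]_k -> 'rV[R]_k) w0 (A : set 'rV[R]_k) :
  (\forall w \near w0, differentiable f w) ->
  (forall u, {for w0, continuous (fun w => 'D_u f w)}) ->
  (forall u, 'd f w0 u = 0 -> u = 0) ->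
  nbhs w0 A -> nbhs (f w0) (f @` A).
Proof.
move=> df cf inj nA.
have df0 : differentiable f w0 by exact: nbhs_singleton df.
pose J := jacobian f w0.
have JE u : 'd f w0 u = u *m J by rewrite -deriveE// deriveEjacobian.
have Ju : J \in unitmx.
  rewrite -row_free_unit -kermx_eq0; apply/rowV0P => u /sub_kermxP uJ.
  by apply: inj; rewrite JE.
have [C C0 hC] := mulmx_bounded (invmx J).
pose c := (2 * C)^-1.
have c0 : 0 < c by rewrite invr_gt0 mulr_gt0.
have Jlow (u : 'rV_k) : 2 * c * `|u| <= `|u *m J|.
  have := hC (u *m J); rewrite mulmxK// => h.
  have -> : 2 * c = C^-1 by rewrite /c; field; rewrite gt_eqF.
  by rewrite mulrC ler_pdivrMr// mulrC.
pose dl := (k.+1%:R * k.+1%:R * C)^-1.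
have dl0 : 0 < dl by rewrite invr_gt0 !mulr_gt0.
have nexp : \forall w \near w0, `|f w - f w0 - (w - w0) *m J| <= c * `|w - w0|.
  have /landau.eqaddoP/(_ c c0) h := diff_locally df0.
  move: h => /nbhs_ballP[r /= r0 h]; apply/nbhs_ballP; exists r => //= w ww.
  have /h : ball (0 : 'rV[R]_k) r (w - w0).
    by move: ww; rewrite !rV_ballE sub0r normrN distrC.
  by rewrite !fctE /= subrK opprD addrA JE.
have ncont : \forall w \near w0, forall i : 'I_k,
    `|'D_(delta_mx 0 i) f w0 - 'D_(delta_mx 0 i) f w| < dl.
  apply: (@filter_forall _ _ _ _ (nbhs_filter w0)) => i.
  by have /cvgrPdist_lt := cf (delta_mx 0 i); apply.
have : \forall w \near w0, [/\ A w, differentiable f w,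
    `|f w - f w0 - (w - w0) *m J| <= c * `|w - w0| &
    forall i : 'I_k, `|'D_(delta_mx 0 i) f w0 - 'D_(delta_mx 0 i) f w| < dl].
  by near=> w; split; near: w.
move=> /nbhs_ballP[r' /= r'0 hr'].
pose r := r' / 2.
have r0 : 0 < r by rewrite divr_gt0.
have hr w : `|w - w0| <= r -> ball w0 r' w.
  move=> wr; rewrite rV_ballE distrC (le_lt_trans wr)//.
  by rewrite ltr_pdivrMr// ltr_pMr// ltr1n.
(* With this [rho], a point at distance [r] from [w0] is sent at least
   [k.+1%:R * rho] away from [y], further than [w0] even in the sum of squares,
   which exceeds the squared supremum norm by a factor of at most [k]. *)
pose rho := c * r / k.+2%:R.
have rho0 : 0 < rho by rewrite divr_gt0// mulr_gt0.
apply/nbhs_ballP; exists rho => //= y; rewrite rV_ballE => fy.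
pose K : set 'rV[R]_k := [set w | `|w - w0| <= r].
have cK : compact K.
  apply: bounded_closed_compact.
    exists (`|w0| + r); split; first exact: num_real.
    move=> N hN w /= wr; apply: le_trans (ltW hN).
    by rewrite -(subrK w0 w) (le_trans (ler_normD _ _))// addrC lerD2l.
  rewrite (_ : K = (fun w => `|w - w0|) @^-1` [set t | t <= r])//.
  apply: closed_comp; last exact: closed_le.
  move=> w _; apply: (continuous_comp (@rV_sub_continuous _ w0 w)).
  exact: norm_continuous.
have fc : {within K, continuous (fun w => sqnorm (f w - y))}.
  apply: continuous_in_subspaceT => w /set_mem /hr/hr'.
  move=> [_ /differentiable_continuous fw _ _].
  have ch : {for w, continuous (fun w => f w - y)}.
    exact: (continuous_comp fw (@rV_sub_continuous _ y (f w))).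
  exact: (continuous_comp ch (@sqnorm_continuous _ _)).
have [|w1 /set_mem Kw1 hmin] := EVT_min_rV _ cK fc.
  by exists w0; rewrite /K /= subrr normr0 ltW.
have hmin' w : K w -> sqnorm (f w1 - y) <= sqnorm (f w - y).
  by move=> Kw; apply: hmin; exact/mem_set.
have [Aw1 dw1 ew1 Dw1] := hr' _ (hr _ Kw1).
have k2 : k.+2%:R * rho = c * r by rewrite [LHS]mulrC divfK ?pnatr_eq0.
have w1r : `|w1 - w0| < r.
  rewrite lt_neqAle Kw1 andbT; apply/eqP => w1r.
  have K0 : K w0 by rewrite /K /= subrr normr0 ltW.
  have := hmin' _ K0; apply/negP; rewrite -ltNge.
  apply: (@le_lt_trans _ _ (k%:R * rho ^+ 2)).
    rewrite (le_trans (sqnorm_le _))// ler_wpM2l//.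
    by rewrite lerXn2r ?nnegrE// ltW.
  apply: lt_le_trans (sqnorm_ge _).
  apply: (@lt_le_trans _ _ ((k.+1%:R * rho) ^+ 2)).
    rewrite [ltRHS]exprMn ltr_pM2r ?exprn_gt0// -natrX ltr_nat.
    by rewrite (leq_trans (ltnSn k))// leq_pmulr.
  have rp : 0 <= k.+1%:R * rho by apply: mulr_ge0 => //; exact: ltW.
  rewrite lerXn2r ?nnegrE//.
  have := ler_normB (f w1 - f w0) (f w1 - f w0 - (w1 - w0) *m J).
  have := ler_normB (f w1 - y) (f w0 - y).
  have := Jlow (w1 - w0); move: k2 ew1 fy.
  rewrite subKr [- (f w0 - y)]opprB addrA subrK w1r -!natr1.
  set k' := k%:R; set a1 := `|_|; set a2 := `|_|; set a3 := `|_|.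
  set a4 := `|_|; set a5 := `|_|.
  lra.
suff fw1 : f w1 = y by exists w1.
set e := y - f w1.
have feE : f w1 - y = - e by rewrite opprB.
(* In the direction [u] the differential at [w0] is [e], so the one at [w1] is
   [e] up to the small error [d]; criticality makes it orthogonal to [e]. *)
pose u := e *m invmx J.
have uC : `|u| <= C * `|e| by exact: hC.
pose d := 'd f w1 u - e.
have dE : d = \sum_i u 0 i *: ('D_(delta_mx 0 i) f w1 - 'D_(delta_mx 0 i) f w0).
  have lu v : 'd f v u = \sum_i u 0 i *: 'd f v (delta_mx 0 i).
    rewrite {1}(row_sum_delta u) linear_sum; apply: eq_bigr => i _.
    by rewrite linearZ.
  have eE : 'd f w0 u = e by rewrite JE mulmxKV.
  have := congr2 (fun a b => a - b) (lu w1) (etrans (esym eE) (lu w0)).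
  rewrite -/d => ->; rewrite -sumrB; apply: eq_bigr => i _; rewrite -scalerBr.
  congr (_ *: _).
  exact: (congr2 (fun a b => a - b) (esym (deriveE _ dw1))
    (esym (deriveE _ df0))).
have dle : `|d| <= k%:R * (`|u| * dl).
  rewrite dE (le_trans (ler_norm_sum _ _ _))//.
  apply: (@le_trans _ _ (\sum_(i < k) `|u| * dl)).
    apply: ler_sum => i _; rewrite normrZ ler_pM// ?rV_norm_coord//.
    by rewrite distrC ltW.
  by rewrite sumr_const card_ord mulr_natl.
have r10 : 0 < r - `|w1 - w0| by rewrite subr_gt0.
have hb a : ball w1 (r - `|w1 - w0|) a -> K a.
  rewrite rV_ballE ltrBrDl => h; rewrite /K /= ltW// (le_lt_trans _ h)//.
  by rewrite [leLHS]distrC -(subrKA w1) (le_trans (ler_normD _ _))// distrC.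
have fb a : ball w1 (r - `|w1 - w0|) a -> differentiable f a.
  by move=> /hb/hr/hr'[].
have mb a : ball w1 (r - `|w1 - w0|) a -> sqnorm (f w1 - y) <= sqnorm (f a - y).
  by move=> /hb/hmin'.
have qe : sqnorm e = - \sum_j e 0 j * d 0 j.
  have du j : 'd f w1 u 0 j = e 0 j + d 0 j.
    have dd (z : 'rV[R]_k) : z 0 j = e 0 j + (z - e) 0 j.
      by rewrite !mxE addrC subrK.
    exact: (dd ('d f w1 u)).
  have := sqnorm_critical u r10 fb mb; rewrite feE.
  rewrite (eq_bigr (fun j => - (e 0 j ^+ 2 + e 0 j * d 0 j))); last first.
    by move=> j _; rewrite du mxE mulNr mulrDr expr2.
  rewrite sumrN big_split /= => /eqP; rewrite oppr_eq0 addr_eq0 => /eqP <-.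
  by [].
have qle : sqnorm e <= k%:R * (`|e| * `|d|).
  rewrite qe -sumrN (le_trans (ler_norm _))// (le_trans (ler_norm_sum _ _ _))//.
  apply: (@le_trans _ _ (\sum_(i < k) `|e| * `|d|)).
    by apply: ler_sum => j _; rewrite normrN normrM ler_pM// rV_norm_coord.
  by rewrite sumr_const card_ord mulr_natl.
suff /eqP : `|e| ^+ 2 = 0.
  by rewrite expf_eq0 /= normr_eq0 subr_eq0 => /eqP.
apply/eqP; rewrite eq_le sqr_ge0 andbT.
have dlE : k.+1%:R * k.+1%:R * C * dl = 1.
  by rewrite divff// !mulf_neq0 ?pnatr_eq0// gt_eqF.
have le1 : `|e| ^+ 2 <= k%:R * (`|e| * (k%:R * (C * `|e| * dl))).
  rewrite (le_trans (sqnorm_ge e))// (le_trans qle)// ler_wpM2l// ler_wpM2l//.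
  by rewrite (le_trans dle)// ler_wpM2l// ler_wpM2r// ltW.
have le2 : k.+1%:R * k.+1%:R * `|e| ^+ 2 <= k%:R * k%:R * `|e| ^+ 2.
  rewrite -[leRHS]mulr1 -[X in _ <= _ * X]dlE.
  have kk : 0 <= k.+1%:R * k.+1%:R :> R by rewrite mulr_ge0.
  apply: (le_trans (ler_wpM2l kk le1)).
  by rewrite le_eqVlt; apply/orP; left; apply/eqP; ring.
have k0 : 0 <= k%:R :> R by [].
have e0 := sqr_ge0 `|e|.
move: le2; rewrite -natr1; nra.
Unshelve. all: by end_near. Qed.

End Calculus.

(** * Smooth maps into a Euclidean space *)

Lemma near_eq_continuous (S T : topologicalType) (f g : S -> T) x :
  (\forall y \near x, f y = g y) -> {for x, continuous f} ->
  {for x, continuous g}.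
Proof.
move=> fg cf; rewrite /prop_for /continuous_at -(nbhs_singleton fg).
by apply: cvg_trans cf; apply: near_eq_cvg; apply: filterS fg => y ->.
Qed.

Section SmoothMaps.
Context {R : realType}.

Lemma derive_addr_cst k l (f : 'rV[R]_k -> 'rV[R]_l) c u :
  'D_u (fun a => f a + c) = 'D_u f.
Proof.
apply/funext => w; rewrite /derive /=.
by under eq_fun do rewrite opprD addrACA subrr addr0.
Qed.

Lemma smooth_on_cst k l (W : set 'rV[R]_k) (c : 'rV[R]_l) : smooth_on W (cst c).
Proof.
move=> m; elim: m c => [|m IH] c /=; first by move=> w _; exact: cst_continuous.
split=> [w _|u]; first exact: differentiable_cst.
suff -> : (fun w => 'D_u (cst c) w) = cst 0 by exact: IH.
by apply/funext => w; exact: derive_cst.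
Qed.

Lemma affine_is_diff k l (c : 'rV[R]_l) (B : 'M[R]_(k, l)) (w : 'rV[R]_k) :
  is_diff w (fun a : 'rV[R]_k => c + a *m B) (fun u : 'rV[R]_k => u *m B).
Proof.
have h := is_diffD (is_diff_cst c w) (mulmx_is_diff B w).
by apply: is_diff_eq h _; rewrite add0r.
Qed.

Lemma smooth_on_affine k l (W : set 'rV[R]_k) (c : 'rV[R]_l) (B : 'M[R]_(k, l)) :
  smooth_on W (fun a => c + a *m B).
Proof.
have dB w := is_diff_elim (affine_is_diff c B w).
case=> [|m] /=.
  move=> w _; exact: differentiable_continuous (dB w).1.
split=> [w _|u]; first exact: (dB w).1.
suff -> : (fun w => 'D_u (fun a => c + a *m B) w) = cst (u *m B).
  exact: smooth_on_cst.
by apply/funext => w; rewrite (deriveE _ (dB w).1) (dB w).2.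
Qed.

Context {E : euclideanSpace R}.
Local Notation n := (\dim {: dir E}).
Implicit Types (x y z o : pt E) (v : dir E) (V : {vspace dir E}).

Lemma acoord_tr o x v : acoord o (tr x v) = acoord o x + vcoord v.
Proof. by rewrite /acoord vsub_tr linearD. Qed.

Lemma acoord_base k o o' (psi : 'rV[R]_k -> pt E) :
  acoord o' \o psi = (fun a => (acoord o \o psi) a + acoord o' o).
Proof.
by apply/funext => a /=; rewrite /acoord -linearD /= vsubD.
Qed.

Section Affine.
Variables (k : nat) (x : pt E) (T : {linear 'rV[R]_k -> dir E}).
Let psi (a : 'rV[R]_k) := tr x (T a).

Let acoord_psi o :
  acoord o \o psi = (fun a => acoord o x + a *m lin1_mx (@vcoord R E \o T)).
Proof. by apply/funext => a; rewrite mul_rV_lin1 /= acoord_tr. Qed.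

Lemma smooth_map_affine W : smooth_map_on W psi.
Proof. by move=> o; rewrite acoord_psi; exact: smooth_on_affine. Qed.

Lemma dmap_affine w : dmap psi w = T.
Proof.
apply/funext => u; rewrite /dmap acoord_psi.
rewrite (is_diff_elim (affine_is_diff _ _ _)).2 mul_rV_lin1 /=.
exact: vcoordK.
Qed.

End Affine.

Lemma smooth_map_differentiable k (W : set 'rV[R]_k) (psi : 'rV[R]_k -> pt E) o w :
  smooth_map_on W psi -> W w -> differentiable (acoord o \o psi) w.
Proof. by move=> /(_ o 1%N)[+ _] Ww; exact. Qed.

Lemma smooth_map_continuous k (W : set 'rV[R]_k) (psi : 'rV[R]_k -> pt E) w :
  smooth_map_on W psi -> W w -> {for w, continuous psi}.
Proof.
move=> sm Ww; have [o] := pt_inhabited E.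
have := differentiable_continuous (smooth_map_differentiable o sm Ww) => cf.
rewrite (_ : psi = achart o \o (acoord o \o psi)); last first.
  by apply/funext => a /=; rewrite acoordK.
exact: (continuous_comp cf (@achart_continuous _ _ o _)).
Qed.

Lemma smooth_map_near k (W : set 'rV[R]_k) (psi : 'rV[R]_k -> pt E) w0 d :
  smooth_map_on W psi -> W w0 -> 0 < d ->
  \forall w \near w0, edist (psi w0) (psi w) < d.
Proof.
move=> sm Ww0 d0; have /(smooth_map_continuous sm Ww0) :
    nbhs (psi w0) [set y | edist (psi w0) y < d] by apply/nbhs_ptP; exists d.
by [].
Qed.

Lemma dmap_derive k (W : set 'rV[R]_k) (psi : 'rV[R]_k -> pt E) o w u :
  smooth_map_on W psi -> W w ->
  dmap psi w u = vofcoord ('D_u (acoord o \o psi) w).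
Proof.
move=> sm Ww; rewrite /dmap -deriveE; last exact: smooth_map_differentiable sm Ww.
rewrite (acoord_base o); congr vofcoord.
exact: (congr1 (fun h => h w) (derive_addr_cst (acoord o \o psi) _ u)).
Qed.

(** The matrix, on coordinates, of a linear map with kernel [V]: membership in
    a plane becomes an equation that can be differentiated. *)
Definition normal_mx V : 'M[R]_n :=
  passmx.mxof (vbasis {: dir E}) (vbasis {: dir E}) (\1 - projv V)%VF.

Lemma normal_mxP V v : reflect (vcoord v *m normal_mx V = 0) (v \in V).
Proof.
rewrite /vcoord -passmx.rVof_app ?vbasisP// add_lfunE opp_lfunE id_lfunE.
apply: (iffP idP) => [vV|/eqP].
  by rewrite projv_id// subrr; exact: linear0 (@vcoord R E).
rewrite passmx.rVof_eq0 ?vbasisP// subr_eq0 => /eqP->; exact: memv_proj.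
Qed.

Lemma normal_mx_vofcoord V a :
  reflect (a *m normal_mx V = 0) ((vofcoord a : dir E) \in V).
Proof. by rewrite -{1}[a]vofcoordK; exact: normal_mxP. Qed.

Lemma acoord_normal V o y z :
  reflect (acoord o y *m normal_mx V = acoord o z *m normal_mx V)
          (vsub y z \in V).
Proof.
rewrite -(vsubB y z o).
apply: (iffP (normal_mxP _ _)); rewrite linearB mulmxBl => h.
  by apply/eqP; rewrite -subr_eq0; apply/eqP.
by rewrite /acoord in h; rewrite h subrr.
Qed.

Section PlaneMaps.
Variables (V : {vspace dir E}) (k : nat) (W : set 'rV[R]_k).
Variable psi : 'rV[R]_k -> pt E.
Hypothesis sm : smooth_map_on W psi.

(** The normal component of such a map has derivative zero. *)
Lemma tangent_stays_in_plane w0 e :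
  ball w0 e `<=` W ->
  (forall w u, ball w0 e w -> dmap psi w u \in V) ->
  forall w, ball w0 e w -> vsub (psi w) (psi w0) \in V.
Proof.
move=> bW dV w ww; have [o] := pt_inhabited E.
apply/(acoord_normal _ o).
pose f a := acoord o (psi a) *m normal_mx V.
rewrite -/(f w) -/(f w0); apply: (@diff0_constant R k n f w0 e) ww => a wa.
have da : differentiable (acoord o \o psi) a.
  exact: smooth_map_differentiable sm (bW _ wa).
have [df dE] := is_diff_elim (diff_mulmxr (normal_mx V) da).
split=> // u; rewrite dE; apply/normal_mx_vofcoord.
by have := dV a u wa; rewrite (dmap_derive o u sm (bW _ wa)) deriveE.
Qed.

Lemma plane_tangent w0 : open W -> W w0 ->
  (\forall w \near w0, vsub (psi w) (psi w0) \in V) ->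
  (forall u, dmap psi w0 u \in V) /\ forall u1 u2, d2map psi w0 u1 u2 \in V.
Proof.
move=> oW Ww0 nV; set o := psi w0; pose f := acoord o \o psi.
have nW : \forall w \near w0, W w by exact: open_nbhs_nbhs.
have df w : W w -> differentiable f w.
  by move=> Ww; exact: smooth_map_differentiable sm Ww.
have ddf w u : W w -> differentiable ('D_u f) w.
  by move=> Ww; have [_ /(_ u)[h _]] := sm o 2%N; exact: h.
(* A function whose values lie near [w0] in the kernel of the normal matrix
   has its derivatives there too. *)
have key (g : 'rV[R]_k -> 'rV[R]_n) u : (forall w, W w -> differentiable g w) ->
    (\forall w \near w0, g w *m normal_mx V = 0) ->
    \forall w \near w0, 'D_u g w *m normal_mx V = 0.
  move=> dg g0.
  have : \forall w \near w0, W w /\ g w *m normal_mx V = 0 by exact: filterI.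
  move=> /nbhs_ballP[r /= r0 hr]; apply/nbhs_ballP; exists r => //= w ww.
  have [Ww _] := hr _ ww.
  rewrite -derive_mulmxr; last exact: dg.
  rewrite (@near_eq_derive _ _ _ _ (cst 0)); first by rewrite derive_cst.
  have : nbhs w (ball w0 r) by apply: open_nbhs_nbhs; split=> //; exact: ball_open.
  by apply: filterS => a wa; have [] := hr _ wa.
have f0 : \forall w \near w0, f w *m normal_mx V = 0.
  by apply: filterS nV => w /normal_mxP.
split=> [u|u1 u2].
  rewrite (dmap_derive o u sm Ww0); apply/normal_mx_vofcoord.
  exact: nbhs_singleton (key f u df f0).
apply/normal_mx_vofcoord.
apply: (@nbhs_singleton _ w0
  (fun w => 'D_u1 ('D_u2 f) w *m normal_mx V = 0)).
by apply: (key _ u1) => [w Ww|]; [exact: ddf | exact: (key _ u2)].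
Qed.

End PlaneMaps.

(** Linear coordinates on [V], extended to all vectors so as to be composed
    with maps into [E]. *)
Definition subcoord V v : 'rV[R]_(\dim V) := \row_i coord (vbasis V) i v.

Lemma subcoord_linear V : linear (subcoord V).
Proof. by move=> a u v; apply/rowP => i; rewrite !mxE linearP. Qed.

HB.instance Definition _ V := GRing.isLinear.Build R (dir E) 'rV[R]_(\dim V) _
  (subcoord V) (subcoord_linear V).

Lemma subcoord_inj V u v : u \in V -> v \in V -> subcoord V u = subcoord V v -> u = v.
Proof.
move=> uV vV /rowP uv; rewrite (coord_vbasis uV) (coord_vbasis vV).
by apply: eq_bigr => i _; have := uv i; rewrite !mxE => ->.
Qed.

(** A map into a plane of its own dimension with injective differential is
    open, by [local_diffeo_open] in the coordinates of the plane. *)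
Lemma immersion_plane_open V (W : set 'rV[R]_(\dim V))
    (psi : 'rV[R]_(\dim V) -> pt E) w0 (A : set 'rV[R]_(\dim V)) :
  open W -> smooth_map_on W psi -> W w0 -> injective (dmap psi w0) ->
  (\forall w \near w0, vsub (psi w) (psi w0) \in V) ->
  nbhs w0 A ->
  exists2 e, 0 < e & forall z, vsub z (psi w0) \in V ->
    edist (psi w0) z < e -> exists2 a, A a & psi a = z.
Proof.
move=> oW sm Ww0 inj nV nA.
have [dV _] := plane_tangent sm oW Ww0 nV.
set o := psi w0.
pose P := lin1_mx (subcoord V \o @vofcoord R E).
have PE y : acoord o y *m P = subcoord V (vsub y o).
  by rewrite mul_rV_lin1 /= vcoordK.
pose f a := (acoord o \o psi) a *m P.
have da a : W a -> differentiable (acoord o \o psi) a.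
  by move=> Wa; exact: smooth_map_differentiable sm Wa.
have nW : \forall w \near w0, W w by exact: open_nbhs_nbhs.
have df : \forall w \near w0, differentiable f w.
  by apply: filterS nW => w /da/(diff_mulmxr P)/is_diff_elim[].
have dfE : 'd f w0 = (fun u => subcoord V (dmap psi w0 u)) :> (_ -> _).
  apply/funext => u; rewrite (is_diff_elim (diff_mulmxr P (da _ Ww0))).2.
  by rewrite mul_rV_lin1.
have dfi u : 'd f w0 u = 0 -> u = 0.
  rewrite dfE => h; apply: inj; apply: (@subcoord_inj V) => //.
  by rewrite h /dmap !linear0.
have cf u : {for w0, continuous (fun w => 'D_u f w)}.
  have nE : \forall w \near w0, 'D_u f w = 'D_u (acoord o \o psi) w *m P.
    by apply: filterS nW => w Ww; rewrite derive_mulmxr//; exact: da.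
  have cD : {for w0, continuous (fun w => 'D_u (acoord o \o psi) w *m P)}.
    have [_ /(_ u) c0] := sm o 1%N.
    exact: (continuous_comp (c0 w0 Ww0) (@mulmxr_continuous _ _ _ P _)).
  by apply: near_eq_continuous cD; apply: filterS nE => w ->.
have nA' : nbhs w0 (A `&` [set w | vsub (psi w) o \in V]) by exact: filterI.
have := local_diffeo_open df cf dfi nA'.
have -> : f w0 = 0 by rewrite /f /= PE vsubxx linear0.
move=> h.
have cP : continuous (fun y => acoord o y *m P).
  move=> y; exact: (continuous_comp (@acoord_continuous _ _ o y)
    (@mulmxr_continuous _ _ _ P _)).
have /cP/nbhs_ptP[e e0 he] : nbhs (acoord o o *m P)
    (f @` (A `&` [set w | vsub (psi w) o \in V])).
  by rewrite PE vsubxx linear0.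
exists e => // z zV /he[a [Aa aV]]; rewrite /f /= !PE => h'.
exists a => //; apply: vsub_eq0.
have := subcoord_inj aV zV h'.
by move=> hh; rewrite -(vsubD _ o) hh (vsubN o) subrr.
Qed.

End SmoothMaps.

(** * Orbit maps and deck transformations *)

Lemma connected_locally_constant (Y : topologicalType) (T : Type) (c : Y -> T) :
  connected [set: Y] -> (forall y, \forall z \near y, c z = c y) ->
  forall y z, c y = c z.
Proof.
move=> cY lc y z.
pose A := [set a | c a = c y].
have oA (t : T) : open [set a | c a = t].
  by rewrite openE => a /= <-; exact: lc.
suff : A = setT by rewrite -subTset => /(_ z I).
apply: cY; first by exists y.
  by exists A; rewrite ?setTI//; exact: oA.
exists A; rewrite ?setTI//; rewrite -openC openE => a /= na.
by apply: filterS (lc a) => b ba; rewrite /A /= ba.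
Qed.

Section EuclideanConnected.
Context {R : realType} {E : euclideanSpace R}.

Lemma connected_pt : connected [set: pt E].
Proof.
have [o] := pt_inhabited E.
pose line (v : dir E) : set (pt E) := (fun t : R => tr o (t *: v)) @` setT.
have -> : [set: pt E] = \bigcup_(v in [set: dir E]) line v.
  apply/esym; rewrite -subTset => x _; exists (vsub x o) => //.
  by exists 1; rewrite // scale1r vsubK.
apply: bigcup_connected.
  by exists o => v _; exists 0; rewrite // scale0r tr0.
move=> v _; apply: connected_continuous_connected.
  by apply/connected_intervalP => a b _ _ c.
apply: continuous_subspaceT => t A /nbhs_ptP[e e0 h].
apply/nbhs_ballP; exists (e / (1 + enorm v)) => /=.
  by rewrite divr_gt0// ltr_pwDl// enorm_ge0.
move=> s; rewrite /ball /= => ts; apply: h; rewrite edist_tr -scalerBl enormZ.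
apply: (@le_lt_trans _ _ (`|t - s| * (1 + enorm v))).
  by rewrite ler_wpM2l// lerDr.
by rewrite -ltr_pdivlMr// ltr_pwDl// enorm_ge0.
Qed.

End EuclideanConnected.

Section OrbitMaps.
Context {R : realType} {E : euclideanSpace R}.
Variable G : isoGroup E.
Implicit Types (x y z : pt E) (g : pt E -> pt E).

(** [q] presents its target as the orbit space of [G]. A leaf covered by a
    plane is such a target: an arbitrary topological space, homeomorphic to
    the orbit space but not equal to it. *)
Record orbit_map (X : topologicalType) (q : pt E -> X) : Prop := OrbitMap {
  orbit_map_fiber : forall x y, q x = q y <-> exists2 g, elts G g & g x = y;
  orbit_map_surj : forall p, exists x, q x = p;
  orbit_map_continuous : continuous q;
  orbit_map_open : forall U, open U -> open (q @` U) }.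

Lemma isometry_open_image g (U : set (pt E)) :
  elts G g -> open U -> open (g @` U).
Proof.
move=> Gg oU; have [h Gh [gh hg]] := eltsV Gg.
rewrite (_ : g @` U = h @^-1` U).
  apply: open_comp oU => x _; exact: (isometry_continuous (elts_iso Gh)).
apply/seteqP; split=> [_ [x Ux <-]|x Ux]; first by rewrite /= gh.
by exists (h x).
Qed.

Section Quotient.
Local Open Scope quotient_scope.

Lemma orbit_projP x y :
  orbit_proj G x = orbit_proj G y <-> exists2 g, elts G g & g x = y.
Proof.
rewrite /orbit_proj; split=> [/eqmodP|h]; first by move=> /asboolP.
by apply/eqmodP/asboolP.
Qed.

Lemma orbit_proj_orbit_map : orbit_map (orbit_proj G).
Proof.
split; first exact: orbit_projP.
- by move=> p; exists (repr p); rewrite /orbit_proj reprK.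
- exact: (@pi_continuous (pt E) _).
- move=> U oU; rewrite /open /= /quotient_open.
  rewrite (_ : _ @^-1` _ = \bigcup_(g in elts G) (g @` U)).
    by apply: bigcup_open => g Gg; exact: isometry_open_image.
  apply/seteqP; split=> [x [y Uy /orbit_projP[g Gg gy]]|x [g Gg [y Uy gy]]].
    by exists g => //; exists y.
  by exists y => //; apply/orbit_projP; exists g.
Qed.

Lemma tangent_projP x v y w :
  mdiff (quotient_mfd G) x v = mdiff (quotient_mfd G) y w <->
  exists2 g, elts G g & g x = y /\ g (tr x v) = tr y w.
Proof.
rewrite /=; split=> [/eqmodP|h]; first by move=> /asboolP.
by apply/eqmodP/asboolP.
Qed.

End Quotient.

Hypothesis dG : deck_like G.

Lemma deck_like_free g h x : elts G g -> elts G h -> g x = h x -> g = h.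
Proof.
move=> Gg Gh gh; have [e e0 he] := dG x.
have [g' Gg' [gg' g'g]] := eltsV Gg.
have /he : elts G (g' \o h) by exact: eltsM.
rewrite /= -gh gg' edistxx => /(_ e0) hE.
by apply/funext => y; rewrite -[RHS]g'g -[g' _]/((g' \o h) y) hE.
Qed.

(** The form in which [deck_like] yields sheets of a covering: distinct
    elements of [G] send a small ball to disjoint balls. *)
Lemma deck_like_close x : exists2 e, 0 < e & forall g h y z,
  elts G g -> elts G h -> edist x y < e -> edist x z < e ->
  g y = h z -> g = h.
Proof.
have [e e0 he] := dG x; exists (e / 2); first by rewrite divr_gt0.
move=> g h y z Gg Gh xy xz gyhz.
have [g' Gg' [gg' g'g]] := eltsV Gg.
have Gk : elts G (g' \o h) by exact: eltsM.
have kz : (g' \o h) z = y by rewrite /= -gyhz gg'.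
have kE : g' \o h = id.
  apply: (he _ Gk); rewrite (le_lt_trans (edist_triangle y _ _))//.
  rewrite (splitr e) ltrD// -{1}kz.
  by rewrite (isometry_edist _ _ (elts_iso Gk)) edist_sym.
by apply/funext => a; rewrite -[RHS]g'g -[g' _]/((g' \o h) a) kE.
Qed.

Section OneMap.
Variables (X : topologicalType) (q : pt E -> X).
Hypothesis qP : orbit_map q.

Lemma orbit_map_local_inj x : exists2 e, 0 < e & forall y z,
  edist x y < e -> edist x z < e -> q y = q z -> y = z.
Proof.
have [e e0 he] := deck_like_close x; exists e => // y z xy xz.
move=> /(orbit_map_fiber qP)[g Gg gy].
by rewrite -gy (he g id y z Gg (elts1 G) xy xz gy).
Qed.

Lemma orbit_map_covering : covering q.
Proof.
split; first exact: orbit_map_continuous qP.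
  by rewrite -subTset => p _; have [x <-] := orbit_map_surj qP p; exists x.
move=> p; have [x <-] := orbit_map_surj qP p.
have [e e0 he] := deck_like_close x.
pose B := [set y | edist x y < e].
have oB : open B by exact: open_edist.
exists (q @` B), {g | elts G g}, (fun k : {g | elts G g} => sval k @` B); split.
- exact: orbit_map_open qP _ oB.
- by exists x; rewrite // /B /= edistxx.
- apply/seteqP; split=> [z [b Bb /(orbit_map_fiber qP)[g Gg gb]]|].
    by exists (exist _ g Gg) => //; exists b.
  move=> _ [[g Gg] _ [b Bb <-]]; exists b => //.
  by apply/(orbit_map_fiber qP); exists g.
- move=> [g Gg] [h Gh] _ _ [_ [[y By <-] /= [z Bz zy]]].
  have gh : g = h by apply: (he g h y z).
  by subst h; congr exist; exact: Prop_irrelevance.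
move=> [g Gg]; split; first exact: isometry_open_image.
have /choice[s hs] : forall u, exists b, (q @` B) u -> B b /\ q b = u.
  move=> u; have [[b Bb bu]|nu] := pselect ((q @` B) u); first by exists b.
  by exists x.
have sq b : B b -> s (q b) = b.
  move=> Bb; have [|Bs qs] := hs (q b); first by exists b.
  have /(orbit_map_fiber qP)[h Gh hsb] := qs.
  by have := hsb; rewrite (he h id (s (q b)) b Gh (elts1 G) Bs Bb hsb).
have qg b : q (g b) = q b.
  by apply/esym/(orbit_map_fiber qP); exists g.
exists (g \o s); split.
- exact/continuous_subspaceT/orbit_map_continuous.
- apply: continuous_in_subspaceT => u /set_mem[b Bb <-] A.
  rewrite /= sq// => /nbhs_ptP[r r0 hr].
  have oC : open (B `&` [set b' | edist b b' < r]).
    by apply: openI oB _; exact: open_edist.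
  have : nbhs (q b) (q @` (B `&` [set b' | edist b b' < r])).
    apply: open_nbhs_nbhs; split; first exact: (orbit_map_open qP).
    by exists b => //; split; rewrite //= edistxx.
  apply: filterS => _ [b' [Bb' bb'] <-]; apply: hr.
  by rewrite /= sq// (isometry_edist _ _ (elts_iso Gg)).
- by move=> _ [b Bb <-]; rewrite qg /= sq//; split=> //; exists b.
- move=> _ [b Bb <-]; rewrite /= sq// qg; split=> //.
  by exists b.
Qed.

(** A deck transformation agrees at each point with an element of [G]; that
    element depends locally constantly on the point. *)
Lemma orbit_map_deck : elts G = deck q.
Proof.
apply/seteqP; split=> [g Gg|f [[cf [f' [cf' ff' f'f]]] qf]].
  have [h Gh [gh hg]] := eltsV Gg; split.
    split; first exact: (isometry_continuous (elts_iso Gg)).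
    by exists h; split=> //; exact: (isometry_continuous (elts_iso Gh)).
  by apply/funext => y /=; apply/esym/(orbit_map_fiber qP); exists g.
have /choice[c hc] : forall x, exists g, elts G g /\ g x = f x.
  move=> x; have /(orbit_map_fiber qP)[g Gg gx] : q x = q (f x).
    by rewrite -[RHS]/((q \o f) x) qf.
  by exists g.
have cl x : \forall y \near x, c y = c x.
  have [e e0 he] := dG (c x x).
  have e20 : 0 < e / 2 by rewrite divr_gt0.
  have /cf : nbhs (f x) [set z | edist (f x) z < e / 2].
    by apply/nbhs_ptP; exists (e / 2).
  move=> nf; have : nbhs x [set y | edist x y < e / 2].
    by apply/nbhs_ptP; exists (e / 2).
  move=> nx; near=> y.
  have fxy : edist (f x) (f y) < e / 2 by near: y; exact: nf.
  have xy : edist x y < e / 2 by near: y; exact: nx.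
  have [Gx cx] := hc x; have [Gy cy] := hc y.
  have [h Gh [xh hx]] := eltsV Gx.
  have Gyh : elts G (c y \o h) by exact: eltsM.
  have hE : c y \o h = id.
    apply: (he _ Gyh); rewrite /= xh (le_lt_trans (edist_triangle (f y) _ _))//.
    rewrite cx (splitr e) ltrD// -cy.
    by rewrite (isometry_edist _ _ (elts_iso Gy)) edist_sym.
  by apply/funext => a; rewrite -{1}(xh a) -[LHS]/((c y \o h) (c x a)) hE.
have [o] := pt_inhabited E.
suff -> : f = c o by have [] := hc o.
apply/funext => x; have [_ <-] := hc x.
by rewrite (connected_locally_constant connected_pt cl x o).
Unshelve. all: by end_near. Qed.

(** Two orbit maps for the same group factor through each other, continuously
    since each is open. *)
Lemma orbit_map_homeo : exists2 h : orbit_space G -> X,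
  homeomorphism h & h \o orbit_proj G = q.
Proof.
have oP := orbit_proj_orbit_map.
have /choice[h hh] : forall p : orbit_space G, exists u, forall x,
    orbit_proj G x = p -> q x = u.
  move=> p; have [x <-] := orbit_map_surj oP p; exists (q x) => y.
  by move=> /(orbit_map_fiber oP)/(orbit_map_fiber qP).
have /choice[k hk] : forall u : X, exists p : orbit_space G, forall x,
    q x = u -> orbit_proj G x = p.
  move=> u; have [x <-] := orbit_map_surj qP u; exists (orbit_proj G x) => y.
  by move=> /(orbit_map_fiber qP)/(orbit_map_fiber oP).
have hE x : h (orbit_proj G x) = q x by exact/esym/hh.
have kE x : k (q x) = orbit_proj G x by exact/esym/hk.
have cont (Y Z : topologicalType) (p : pt E -> Y) (r : pt E -> Z) (f : Y -> Z) :
    orbit_map p -> orbit_map r -> f \o p = r -> continuous f.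
  move=> pP rP fp; apply/continuousP => A oA.
  rewrite (_ : f @^-1` A = p @` (r @^-1` A)).
    apply: (orbit_map_open pP); apply: open_comp oA => x _.
    exact: (orbit_map_continuous rP).
  rewrite -fp; apply/seteqP; split=> [y Ay|_ [x Ax <-]//].
  by have [x xy] := orbit_map_surj pP y; exists x => //=; rewrite xy.
exists h; last exact/funext.
split; first by apply: (cont _ _ _ _ _ oP qP); exact/funext.
exists k; split.
- by apply: (cont _ _ _ _ _ qP oP); exact/funext.
- by move=> p; have [x <-] := orbit_map_surj oP p; rewrite hE kE.
- by move=> u; have [x <-] := orbit_map_surj qP u; rewrite kE hE.
Qed.

End OneMap.

(** An element of [G] is isolated by its value at a single point, a condition
    that is open in the compact-open topology. *)
Lemma deck_like_discrete : discrete_subgroup G.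
Proof.
move=> g Gg; have [o] := pt_inhabited E; have [e e0 he] := dG o.
exists [set h : {compact-open, pt E -> pt E} |
         h @` [set o] `<=` [set y | edist (g o) y < e]].
  apply: compact_open_open; [exact: compact_set1 | exact: open_edist].
apply/seteqP; split=> [h [/= hU Gh]|h /= ->]; last first.
  by split=> // _ [_ -> <-] /=; rewrite edistxx.
have [g' Gg' [gg' g'g]] := eltsV Gg.
have hE : g' \o h = id.
  apply: he; first exact: eltsM.
  rewrite -{1}(gg' o) /= (isometry_edist _ _ (elts_iso Gg')).
  by apply: hU; exists o.
by apply/funext => a; rewrite -[LHS]g'g -[g' _]/((g' \o h) a) hE.
Qed.

End OrbitMaps.

(** * Restriction of a group to a plane *)

Section Restriction.
Context {R : realType} {E : euclideanSpace R}.
Variables (G : isoGroup E) (V : {vspace dir E}) (o : pt E).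
Implicit Types (x y z : pt E) (g h : pt E -> pt E).

Local Notation E' := (affine_subspace V o).
Local Notation S := (parallel_affine V o).
Local Notation Sigma := (setwise_stabilizer G S).

Lemma parallel_affineP x y : parallel_affine V x y <-> vsub y x \in V.
Proof.
split=> [[v /= vV <-]|yV]; first by rewrite trK.
by exists (vsub y x); rewrite //= vsubK.
Qed.

Lemma sub_incl_inj : injective (@sub_incl R E V o).
Proof.
move=> [y hy] [z hz]; rewrite /sub_incl /= => yz; subst z.
by congr exist; exact: bool_irrelevance.
Qed.

Lemma sub_inclP (y : pt E') : vsub (sub_incl y) o \in V.
Proof. exact: svalP y. Qed.

Lemma sub_incl_vsub (y z : pt E') : vsub (sub_incl y) (sub_incl z) \in V.
Proof. by rewrite -(vsubB _ _ o) rpredB// sub_inclP. Qed.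

Lemma edist_sub (y z : pt E') : edist (sub_incl y) (sub_incl z) = edist y z.
Proof. by []. Qed.

Lemma sub_incl_tr (y : pt E') (v : dir E') :
  sub_incl (tr y v) = tr (sub_incl y) (vsval (v : subvs_of V)).
Proof. by []. Qed.

Definition sub_lift y (yV : vsub y o \in V) : pt E' :=
  exist (fun y => is_true (vsub y o \in V)) y yV.

Lemma sub_liftK y (yV : vsub y o \in V) : sub_incl (sub_lift yV) = y.
Proof. by []. Qed.

(** The form of holonomy invariance that does not mention linear parts, and is
    inherited by subgroups. *)
Definition preserves_direction := forall g x y, elts G g ->
  vsub x y \in V -> vsub (g x) (g y) \in V.

Lemma holonomy_invariant_preserves : holonomy_invariant G V ->
  preserves_direction.
Proof.
move=> hV g x y Gg xyV; have [A gA] := isometry_linear_part (elts_iso Gg).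
rewrite -(vsubK y x) gA trK.
have /subvP : (A @: V <= V)%VS by apply: hV; exists g.
by apply; exact: memv_img.
Qed.

Hypothesis pV : preserves_direction.

(** As [G] permutes the planes parallel to [V], one point decides whether an
    element preserves the plane. *)
Lemma stabilizerP g x :
  elts G g -> vsub x o \in V -> vsub (g x) o \in V <-> elts Sigma g.
Proof.
move=> Gg xV; split=> [gxV|[_ gS]]; last first.
  by apply/parallel_affineP; rewrite -gS; exists x => //; exact/parallel_affineP.
split=> //; have [h Gh [gh hg]] := eltsV Gg.
apply/seteqP; split=> [_ [y /parallel_affineP yV <-]|y /parallel_affineP yV].
  apply/parallel_affineP; rewrite -(vsubB _ _ (g x)) rpredB//.
    by apply: pV => //; rewrite -(vsubB _ _ o) rpredB.
  by rewrite vsubN rpredN.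
exists (h y); last exact: hg.
apply/parallel_affineP; rewrite -(vsubB _ _ x) rpredB//.
  rewrite -(gh x); apply: pV => //.
  by rewrite -(vsubB _ _ o) rpredB.
by rewrite vsubN rpredN.
Qed.

Lemma stabilizer_elts g : elts Sigma g -> elts G g. Proof. by case. Qed.

(** The identity is a default value, taken only where [g] leads out of the
    plane. *)
Definition sub_restrict g (y : pt E') : pt E' :=
  if pselect (vsub (g (sub_incl y)) o \in V) is left yV then sub_lift yV else y.

Lemma sub_restrictE g : elts Sigma g -> restricts_to g (sub_restrict g).
Proof.
move=> Sg y; rewrite /sub_restrict; case: pselect => // -[].
exact/(stabilizerP (stabilizer_elts Sg) (sub_inclP y)).
Qed.

Lemma restricts_to_unique g (f f' : pt E' -> pt E') :
  restricts_to g f -> restricts_to g f' -> f = f'.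
Proof. by move=> gf gf'; apply/funext => y; apply: sub_incl_inj; rewrite gf gf'. Qed.

Lemma restricts_to_comp g h (f f' : pt E' -> pt E') :
  restricts_to g f -> restricts_to h f' -> restricts_to (g \o h) (f \o f').
Proof. by move=> gf hf y /=; rewrite gf hf. Qed.

Lemma restricts_to_id : restricts_to (id : pt E -> pt E) (id : pt E' -> pt E').
Proof. by []. Qed.

Lemma restricts_to_cancel g h (f f' : pt E' -> pt E') :
  restricts_to g f -> restricts_to h f' -> cancel g h -> cancel f f'.
Proof. by move=> gf hf gh y; apply: sub_incl_inj; rewrite hf gf gh. Qed.

Definition restriction_group : isoGroup E'.
Proof.
refine (@IsoGroup R E'
  [set f | exists2 g, elts Sigma g & restricts_to g f] _ _ _ _).
- move=> f [g Sg gf]; have [h Sh [gh hg]] := eltsV Sg.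
  have hr := sub_restrictE Sh; split.
    exists (sub_restrict h); first exact: restricts_to_cancel gf hr gh.
    exact: restricts_to_cancel hr gf hg.
  move=> y z; rewrite -[LHS]/(edist (sub_incl (f y)) (sub_incl (f z))) !gf.
  exact: isometry_edist (elts_iso Sg).
- by exists id; [exact: elts1 | exact: restricts_to_id].
- move=> f f' [g Sg gf] [h Sh hf]; exists (g \o h); first exact: eltsM.
  exact: restricts_to_comp.
- move=> f [g Sg gf]; have [h Sh [gh hg]] := eltsV Sg.
  have hr := sub_restrictE Sh.
  exists (sub_restrict h); first by exists h.
  split; first exact: restricts_to_cancel gf hr gh.
  exact: restricts_to_cancel hr gf hg.
Defined.

Local Notation G' := restriction_group.

(** Points of the plane with the same image in the quotient by [G] are related
    by the restricted group, so the quotient of the plane injects into it. *)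
Lemma restriction_fiber (y z : pt E') :
  (exists2 g, elts G g & g (sub_incl y) = sub_incl z) <->
  exists2 f, elts G' f & f y = z.
Proof.
split=> [[g Gg gy]|[f [g Sg gf] fy]]; last first.
  by exists g; [exact: stabilizer_elts Sg | rewrite -gf fy].
have Sg : elts Sigma g.
  by apply/(stabilizerP Gg (sub_inclP y)); rewrite gy sub_inclP.
have gr := sub_restrictE Sg; exists (sub_restrict g); first by exists g.
by apply: sub_incl_inj; rewrite gr.
Qed.

Lemma lattice_restriction :
  [set v : dir E' | lattice G (vsval (v : subvs_of V))] `<=` lattice G'.
Proof.
move=> v Gv; exists (tr^~ (vsval (v : subvs_of V))) => //.
apply/(stabilizerP Gv (x := o)); first by rewrite vsubxx mem0v.
by rewrite trK subvsP.
Qed.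

Lemma holonomy_restriction : holonomy G' =
  [set B | exists2 A, holonomy Sigma A & linear_restricts_to A B].
Proof.
apply/seteqP; split=> [B [f [g Sg gf] fB]|B [A [g Sg gA] AB]].
  have [A gA] := isometry_linear_part (elts_iso Sg).
  exists A; first by exists g.
  move=> v; have y : pt E' by apply: (@sub_lift o); rewrite vsubxx mem0v.
  apply: (@tr_inj _ _ (g (sub_incl y))); rewrite -gA -(sub_incl_tr y v) -!gf fB.
  by [].
have gr := sub_restrictE Sg; exists (sub_restrict g); first by exists g.
move=> y v; apply: sub_incl_inj; rewrite gr !sub_incl_tr gr gA.
by rewrite -(AB v).
Qed.

Hypothesis dG : deck_like G.

Lemma restriction_deck_like : deck_like G'.
Proof.
move=> y; have [e e0 he] := dG (sub_incl y); exists e => // f [g Sg gf].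
rewrite -edist_sub gf => /(he _ (stabilizer_elts Sg)) gE; subst g.
exact: restricts_to_unique gf restricts_to_id.
Qed.

Lemma restriction_torsion_free : torsion_free G -> torsion_free G'.
Proof.
move=> tG f n [g Sg gf] n0 fn.
have Gg := stabilizer_elts Sg.
have gfn m (y : pt E') : sub_incl (iter m f y) = iter m g (sub_incl y).
  by elim: m => //= m <-; rewrite gf.
have y : pt E' by apply: (@sub_lift o); rewrite vsubxx mem0v.
have gn : iter n g = id.
  apply: (deck_like_free dG (elts_iter n Gg) (elts1 G) (x := sub_incl y)).
  by rewrite -gfn fn.
have gE : g = id by apply: (tG g n) => // z; rewrite gn.
by subst g; exact: restricts_to_unique gf restricts_to_id.
Qed.

Lemma restriction_iso : exists rho : (pt E -> pt E) -> (pt E' -> pt E'),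
  [/\ forall g, elts Sigma g -> restricts_to g (rho g),
      forall g h, elts Sigma g -> elts Sigma h -> rho (g \o h) = rho g \o rho h &
      set_bij (elts Sigma) (elts G') rho].
Proof.
exists sub_restrict; split; first exact: sub_restrictE.
  move=> g h Sg Sh; apply: (@restricts_to_unique (g \o h)).
    by apply: sub_restrictE; exact: eltsM.
  by apply: restricts_to_comp; exact: sub_restrictE.
split.
- by move=> g Sg; exists g => //; exact: sub_restrictE.
- move=> g h /set_mem Sg /set_mem Sh gh.
  have y : pt E' by apply: (@sub_lift o); rewrite vsubxx mem0v.
  apply: (deck_like_free dG (stabilizer_elts Sg) (stabilizer_elts Sh)
    (x := sub_incl y)).
  by rewrite -(sub_restrictE Sg) -(sub_restrictE Sh) gh.
- move=> f [g Sg gf]; exists g => //.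
  by apply: restricts_to_unique gf; exact: sub_restrictE.
Qed.

Lemma latticeD u v : lattice G u -> lattice G v -> lattice G (u + v).
Proof.
move=> Gu Gv; rewrite /lattice /=.
have -> : (fun x => tr x (u + v)) = (tr^~ v) \o (tr^~ u).
  by apply/funext => x /=; rewrite trA.
exact: eltsM.
Qed.

Lemma lattice0 : lattice G 0.
Proof.
rewrite /lattice /=; have -> : (fun x => tr x 0) = id :> (pt E -> pt E).
  by apply/funext => x; rewrite tr0.
exact: elts1.
Qed.

Lemma latticeN v : lattice G v -> lattice G (- v).
Proof.
move=> Gv; have [h Gh [vh hv]] := eltsV Gv.
rewrite /lattice /=; have -> : (fun x => tr x (- v)) = h; last by [].
by apply/funext => x; rewrite -{1}(hv x) trA subrr tr0.
Qed.

Lemma latticeMz v m : lattice G v -> lattice G (v *~ m).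
Proof.
move=> Gv; have nat_mul n : lattice G (v *+ n).
  elim: n => [|n IH]; first by rewrite mulr0n; exact: lattice0.
  by rewrite mulrS; exact: latticeD.
case: m => n; first exact: nat_mul.
by rewrite NegzE mulrNz; apply: latticeN; exact: nat_mul.
Qed.

(** Subtracting the integer parts of its coordinates on lattice vectors that
    span the plane moves a point into a bounded region. *)
Lemma restriction_cocompact : lattice_subspace G V -> cocompact G'.
Proof.
move=> [s sL sV]; pose r := \sum_(v <- s) enorm v.
have oV : vsub o o \in V by rewrite vsubxx mem0v.
pose o' : pt E' := sub_lift oV.
have [C C0 hC] := @vcoord_bounded R E'.
exists (@achart R E' o' @` [set a | `|a| <= C * r]); first exact: achart_ball_compact.
have spanV v : v \in V -> v \in <<in_tuple s>>%VS by rewrite -{1}sV.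
move=> y; have /spanV/coord_span := sub_inclP y.
set c := fun i => coord (in_tuple s) i (vsub (sub_incl y) o) => yE.
pose w := \sum_(i < size s) s`_i *~ - Num.floor (c i).
have sP (i : 'I_(size s)) : lattice G s`_i /\ s`_i \in V.
  by apply: sL; rewrite mem_nth.
have wV : w \in V.
  by apply: rpred_sum => i _; rewrite rpredMz// (sP i).2.
have wL : lattice G w.
  rewrite /w; elim/big_rec: _ => [|i z _ IH]; first exact: lattice0.
  by apply: latticeD => //; apply: latticeMz; exact: (sP i).1.
pose w' : dir E' := Subvs wV.
exists (tr^~ w'); first exact: (@lattice_restriction w' wL).
exists (acoord o' (tr y w')); last exact: acoordK.
rewrite /= /acoord (le_trans (hC _))// ler_pM2l//.
rewrite -[enorm _]/(enorm (vsub (tr (sub_incl y) w) o)) vsub_tr yE /w -big_split /=.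
apply: (@le_trans _ _ (\sum_(i < size s) enorm s`_i)); last first.
  by rewrite /r (big_nth 0) big_mkord.
elim/big_ind2: _ => [|a1 b1 a2 b2 h1 h2|i _]; first by rewrite enorm0.
  by rewrite (le_trans (enormD _ _))// lerD.
rewrite -scaler_int -scalerDl enormZ ler_piMl ?enorm_ge0// mulrNz.
have /andP[f1 f2] := mem_rg1_floor (c i).
rewrite /= ger0_norm ?subr_ge0// lerBlDr addrC.
by rewrite ltW// -[X in _ + X]/(1%:~R) -intrD.
Qed.

End Restriction.

(** * Leaves *)

Section Leaves.
Context {R : realType} {E : euclideanSpace R}.
Variables (G : isoGroup E) (N : flatManifold E) (V : {vspace dir E}).
Implicit Types (x y z : pt E) (g h : pt E -> pt E) (p : mcar N).

(** What the models [euclid_mfd] and [quotient_mfd] have in common: points and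
    tangent vectors of [N] are orbits of the action of [G] on those of [E]. *)
Record quotient_model : Prop := QuotientModel {
  model_orbit : orbit_map G (mproj N);
  model_tangent : forall x v y w, mdiff N x v = mdiff N y w <->
    exists2 g, elts G g & g x = y /\ g (tr x v) = tr y w }.

Definition plane_distribution : distribution N :=
  fun p => [set t | exists x v, [/\ mproj N x = p, v \in V & t = mdiff N x v]].

(** The image in [N] of the plane through a lift of [p]: the leaf of [p], in a
    form that does not choose the lift. *)
Definition plane_class p : set (mcar N) :=
  [set r | exists x y, [/\ mproj N x = p, mproj N y = r & vsub y x \in V]].

Local Notation F := plane_distribution.
Local Notation k := (\dim V).

Hypothesis mN : quotient_model.
Hypothesis dG : deck_like G.
Hypothesis pV : preserves_direction G V.

Let pr_fiber := orbit_map_fiber (model_orbit mN).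

Lemma pr_elts g x : elts G g -> mproj N (g x) = mproj N x.
Proof. by move=> Gg; apply/esym/pr_fiber; exists g. Qed.

Lemma plane_distributionE x : F (mproj N x) = mdiff N x @` [set` V].
Proof.
apply/seteqP; split=> [_ [y [v [/pr_fiber[g Gg gy] vV ->]]]|_ [v /= vV <-]].
  exists (vsub (g (tr y v)) x).
    by rewrite /= -gy; apply: pV => //; rewrite trK.
  by apply/esym/(model_tangent mN); exists g; rewrite ?vsubK.
by exists x, v.
Qed.

(** An element of [G] fixing [x] is the identity, and so identifies no two
    tangent vectors there. *)
Lemma mdiff_inj x : injective (mdiff N x).
Proof.
move=> v w /(model_tangent mN)[g Gg [gx]].
have gE : g = id by apply: (deck_like_free dG Gg (elts1 G) gx).
by rewrite gE => /tr_inj.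
Qed.

Lemma plane_distribution_smooth : smooth_distribution k F.
Proof.
move=> x0; exists setT, (fun i _ => (vbasis V)`_i); split=> //.
- exact: openT.
- by move=> i o; exact: smooth_on_cst.
- move=> x _.
  have -> : [tuple (vbasis V)`_i | i < k] = vbasis V.
    by apply: eq_from_tnth => i; rewrite tnth_mktuple (tnth_nth 0).
  split; first exact: basis_free (vbasisP V).
  by rewrite (span_basis (vbasisP V)) plane_distributionE.
Qed.

Lemma plane_distribution_parallel : parallel_distribution F.
Proof.
move=> x y v; rewrite !plane_distributionE => -[w wV /mdiff_inj <-].
by exists w.
Qed.

Lemma plane_class_mproj x : plane_class (mproj N x) = mproj N @` parallel_affine V x.
Proof.
apply/seteqP; split=> [_ [x' [y [/pr_fiber[g Gg gx'] <- yx']]]|_ [y yx <-]].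
  exists (g y); last exact: pr_elts.
  by apply/parallel_affineP; rewrite -gx'; exact: pV.
by exists x, y; split=> //; exact/parallel_affineP.
Qed.

Lemma plane_class_eq x y :
  vsub y x \in V -> plane_class (mproj N y) = plane_class (mproj N x).
Proof.
move=> yx; rewrite !plane_class_mproj; congr image.
apply/seteqP; split=> z /parallel_affineP zV; apply/parallel_affineP.
  by rewrite -(vsubB _ _ y) rpredB// vsubN rpredN.
by rewrite -(vsubB _ _ x) rpredB.
Qed.

Lemma plane_class_refl p : plane_class p p.
Proof.
have [x <-] := orbit_map_surj (model_orbit mN) p.
by exists x, x; rewrite vsubxx mem0v.
Qed.

Section OneManifold.
Variables (X : topologicalType) (i : X -> mcar N).
Hypothesis iI : integral_manifold i k F.

Lemma integral_chart_in_plane a : exists W phi psi w0 e,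
  [/\ @local_param R E N X i k W phi psi, ball w0 e `<=` W, phi w0 = a, 0 < e &
      forall w, ball w0 e w -> vsub (psi w) (psi w0) \in V].
Proof.
have [_ /(_ a)[W [phi [psi [lp [w0 Ww0 w0a] tan]]]]] := iI.
have [oW _ sm _ lift] := lp.
have /nbhs_ballP[e /= e0 he] : nbhs w0 W by exact: open_nbhs_nbhs.
exists W, phi, psi, w0, e; split=> //.
apply: (tangent_stays_in_plane sm he) => w u /he Ww.
have : (mdiff N (psi w) @` range (dmap psi w)) (mdiff N (psi w) (dmap psi w u)).
  by exists (dmap psi w u) => //; exists u.
by rewrite -tan// lift// plane_distributionE => -[v vV /mdiff_inj <-].
Qed.

(** The plane through a lift of a point, seen in [N], is locally constant
    along an integral manifold. *)
Lemma connected_integral_in_plane : connected [set: X] ->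
  forall a b, plane_class (i a) (i b).
Proof.
move=> cX a b; suff -> : plane_class (i a) = plane_class (i b).
  exact: plane_class_refl.
apply: (connected_locally_constant cX (c := fun a => plane_class (i a))) => {}a.
have [W [phi [psi [w0 [e [[_ [_ _ op] _ _ lift] bW <- e0 hV]]]]]] :=
  integral_chart_in_plane a.
have w0b : ball w0 e w0 by exact: ballxx.
have : nbhs (phi w0) (phi @` ball w0 e).
  apply: open_nbhs_nbhs; split; last by exists w0.
  by apply: op => //; exact: ball_open.
apply: filterS => _ [w wb <-].
by rewrite !lift//; [exact/plane_class_eq/hV | exact: bW | exact: bW].
Qed.

(** A lift to [E] of a parametrization of [X] differs from the lift of a
    parametrization tangent to the planes by an element of [G], constant near
    a point by proper discontinuity. *)
Lemma local_param_in_plane W phi psi w0 :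
  @local_param R E N X i k W phi psi -> W w0 ->
  \forall w \near w0, vsub (psi w) (psi w0) \in V.
Proof.
move=> [oW [_ cphi _] sm _ lift] Ww0.
have [W2 [phi2 [psi2 [w2 [r [[_ [_ _ op2] sm2 _ lift2] bW2 w2E r0 hV]]]]]] :=
  integral_chart_in_plane (phi w0).
have w2b : ball w2 r w2 by exact: ballxx.
have /pr_fiber[g0 Gg0 g0E] : mproj N (psi2 w2) = mproj N (psi w0).
  by rewrite -lift2 -?lift ?w2E//; exact: bW2.
have [e e0 he] := dG (psi w0).
have e20 : 0 < e / 2 by rewrite divr_gt0.
have cpsi : \forall w \near w0, edist (psi w0) (psi w) < e / 2.
  exact: smooth_map_near sm Ww0 e20.
have cpsi2 : \forall w \near w2, edist (psi2 w2) (psi2 w) < e / 2.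
  exact: smooth_map_near sm2 (bW2 _ w2b) e20.
have : \forall w \near w2, ball w2 r w /\ edist (psi2 w2) (psi2 w) < e / 2.
  by apply: filterI => //; exact: nbhsx_ballx.
move=> /nbhs_ballP[r' /= r'0 hr'].
have nO : nbhs (phi w0) (phi2 @` ball w2 r').
  apply: open_nbhs_nbhs; split; last by rewrite -w2E; exists w2 => //; exact: ballxx.
  by apply: op2; [move=> w /hr'[/bW2] | exact: ball_open].
have nW : \forall w \near w0, W w by exact: open_nbhs_nbhs.
have nphi := cphi _ Ww0 _ nO.
have : \forall w \near w0, [/\ W w, edist (psi w0) (psi w) < e / 2 &
    (phi2 @` ball w2 r') (phi w)].
  by apply: filterS3 nW cpsi nphi.
apply: filterS => w [Ww we [w' /hr'[w'r w'e] w'E]].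
have /pr_fiber[g Gg gE] : mproj N (psi2 w') = mproj N (psi w).
  by rewrite -lift2 -?lift ?w'E//; exact: bW2.
have [h Gh [g0h hg0]] := eltsV Gg0.
have gh : g \o h = id.
  apply: (he _ (eltsM Gg Gh)); rewrite /= -{2}g0E g0h.
  rewrite (le_lt_trans (edist_triangle (psi w) _ _))// (splitr e) ltrD//.
  by rewrite -gE (isometry_edist _ _ (elts_iso Gg)) edist_sym.
rewrite -gE -g0E; have -> : g = g0.
  by apply/funext => y; rewrite -{1}(g0h y) -[LHS]/((g \o h) (g0 y)) gh.
by apply: pV => //; exact: hV.
Qed.

(** By dimension the first derivatives of a lift fill [V], so a vector
    orthogonal to them is orthogonal to the second derivatives, which also lie
    in [V]. *)
Lemma integral_totally_geodesic : totally_geodesic i k.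
Proof.
move=> W phi psi lp w u1 u2 v Ww vn.
have nV := local_param_in_plane lp Ww.
have [oW _ sm inj _] := lp.
have [dV d2V] := plane_tangent sm oW Ww nV.
pose M := lin1_mx (subcoord V \o (@vofcoord R E \o 'd (acoord (psi w) \o psi) w)).
have ME u : u *m M = subcoord V (dmap psi w u) by rewrite mul_rV_lin1.
have Mu : M \in unitmx.
  rewrite -row_free_unit -kermx_eq0; apply/rowV0P => u /sub_kermxP.
  rewrite ME => uM; apply: (inj w Ww); apply: (@subcoord_inj _ _ V) => //.
  by rewrite uM /dmap !linear0.
have sur (t : dir E) : t \in V -> exists u, dmap psi w u = t.
  move=> tV; exists (subcoord V t *m invmx M).
  by apply: (@subcoord_inj _ _ V) => //; rewrite -ME mulmxKV.
by have [u <-] := sur _ (d2V u1 u2).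
Qed.

End OneManifold.

Section Plane.
Variable o : pt E.
Local Notation E' := (affine_subspace V o).
Local Notation G' := (restriction_group o pV).
Let dG' : deck_like G' := restriction_deck_like pV dG.

(** The linear part of an affine chart of the plane, with values in [dir E]. *)
Definition sub_vofcoord (a : 'rV[R]_(\dim {: dir E'})) : dir E :=
  vsval (vofcoord a : subvs_of V).

Lemma sub_vofcoord_linear : linear sub_vofcoord.
Proof. by move=> a u v; rewrite /sub_vofcoord vofcoord_linear; exact: linearP. Qed.

HB.instance Definition _ := GRing.isLinear.Build R _ (dir E) _
  sub_vofcoord sub_vofcoord_linear.

Lemma sub_vofcoord_inj : injective sub_vofcoord.
Proof. by move=> u v /val_inj h; exact: (can_inj (@vofcoordK R E') h). Qed.

Lemma range_sub_vofcoord : range sub_vofcoord = [set` V].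
Proof.
apply/seteqP; split=> [_ [a _ <-]|v vV]; first exact: subvsP.
exists (vcoord (Subvs vV : dir E')) => //.
by rewrite /sub_vofcoord vcoordK.
Qed.

Section OneQuotient.
Variables (X : topologicalType) (i : X -> mcar N) (q : pt E' -> X).
Hypothesis qP : orbit_map G' q.
Hypothesis iq : i \o q = mproj N \o @sub_incl R E V o.

(** An affine chart of the plane, restricted to a ball on which [q] is
    injective, parametrizes [X]. *)
Lemma plane_local_param (x : pt E') : exists (W : set 'rV[R]_(\dim {: dir E'})) psi,
  [/\ W 0, local_param i W (q \o achart x) psi & forall w, dmap psi w = sub_vofcoord].
Proof.
have [e e0 he] := orbit_map_local_inj dG' qP x.
pose W := achart x @^-1` [set y | edist x y < e].
pose psi a := tr (sub_incl x) (sub_vofcoord a).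
exists W, psi; split; last by move=> w; exact: dmap_affine.
  by rewrite -[W 0]/(is_true (edist x (achart x 0) < e)) achart0 edistxx.
split.
- apply: (@open_comp _ _ (achart x)); last exact: open_edist.
  by move=> a _; exact: achart_continuous.
- split.
  + move=> a b /set_mem/set_mem Wa /set_mem/set_mem Wb /(he _ _ Wa Wb).
    exact: can_inj (achartK x) a b.
  + move=> a _; apply: (continuous_comp (@achart_continuous _ _ x a)).
    exact: (orbit_map_continuous qP).
  + move=> W' _ oW'; rewrite -image_comp; apply: (orbit_map_open qP).
    rewrite (_ : _ @` _ = acoord x @^-1` W').
      by apply: open_comp oW' => y _; exact: acoord_continuous.
    apply/seteqP; split=> [_ [a W'a <-]|y W'y]; first by rewrite /= achartK.
    by exists (acoord x y) => //; rewrite acoordK.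
- exact: smooth_map_affine.
- by move=> w _; rewrite dmap_affine; exact: sub_vofcoord_inj.
- by move=> w _; rewrite -[LHS]/((i \o q) (achart x w)) iq.
Qed.

Lemma plane_riemannian_covering : riemannian_covering i q.
Proof.
split; first exact: orbit_map_covering dG' _ _ qP.
move=> x; have [W [psi [W0 lp dpsi]]] := plane_local_param x.
by exists W, psi; split=> // w u _; rewrite dpsi.
Qed.

Lemma dim_sub : \dim {: dir E'} = k.
Proof. by rewrite dimvf. Qed.

Lemma plane_integral_manifold : injective i -> integral_manifold i k F.
Proof.
move=> ii; rewrite -dim_sub; split=> // a.
have [x <-] := orbit_map_surj qP a.
have [W [psi [W0 lp dpsi]]] := plane_local_param x.
exists W, (q \o achart x), psi; split=> //.
  by exists 0; rewrite // -[LHS]/(q (achart x 0)) achart0.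
move=> w Ww; have [_ _ _ _ ->//] := lp.
by rewrite plane_distributionE dpsi range_sub_vofcoord.
Qed.

Lemma plane_compact : cocompact G' -> compact [set: X].
Proof.
move=> [K cK hK]; have -> : [set: X] = q @` K.
  apply/esym; rewrite -subTset => a _; have [x <-] := orbit_map_surj qP a.
  have [f Gf Kf] := hK x; exists (f x) => //.
  by apply/esym/(orbit_map_fiber qP); exists f.
apply: continuous_compact cK; apply: continuous_subspaceT.
exact: (orbit_map_continuous qP).
Qed.

End OneQuotient.

(** A connected integral manifold containing this image lies in the image of a
    single plane, hence is no larger. *)
Lemma plane_leaf : exists (X : topologicalType) (i : X -> mcar N),
  leaf k F i /\ range i = mproj N @` parallel_affine V o.
Proof.
have qP := orbit_proj_orbit_map G'; set q := orbit_proj G' in qP.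
have /choice[i hi] : forall a : orbit_space G', exists p, forall x : pt E',
    q x = a -> p = mproj N (sub_incl x).
  move=> a; have [x <-] := orbit_map_surj qP a.
  exists (mproj N (sub_incl x)) => y /(orbit_map_fiber qP)/restriction_fiber h.
  by apply/esym/pr_fiber.
have iqx (x : pt E') : i (q x) = mproj N (sub_incl x) by exact: hi.
have iq : i \o q = mproj N \o @sub_incl R E V o by exact/funext.
have ii : injective i.
  move=> a b; have [x <-] := orbit_map_surj qP a.
  have [y <-] := orbit_map_surj qP b; rewrite !iqx => /pr_fiber h.
  by apply/(orbit_map_fiber qP)/restriction_fiber.
have ri : range i = mproj N @` parallel_affine V o.
  rewrite -range_sub_incl image_comp -iq; apply/seteqP; split.
    by move=> _ [a _ <-]; have [x <-] := orbit_map_surj qP a; exists x.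
  by move=> _ [x _ <-]; exists (q x).
have o' : pt E' by apply: (@sub_lift _ _ V o o); rewrite vsubxx mem0v.
exists (orbit_space G'), i; split=> //; split.
- exact: plane_integral_manifold qP iq ii.
- have -> : [set: orbit_space G'] = q @` setT.
    apply/esym; rewrite -subTset => a _; have [x <-] := orbit_map_surj qP a.
    by exists x.
  apply: connected_continuous_connected; first exact: connected_pt.
  exact/continuous_subspaceT/(orbit_map_continuous qP).
- by exists (q o').
move=> Y j jI cY ij; apply/seteqP; split=> // _ [b _ <-].
have [a _ ja] : range j (i (q o')) by apply: ij; exists (q o').
have := connected_integral_in_plane jI cY a b.
rewrite ja iqx plane_class_mproj ri => -[y /parallel_affineP yV <-].
exists y => //; apply/parallel_affineP.
by rewrite -(vsubD o (sub_incl o')) rpredD// sub_inclP.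
Qed.

(** [q y] is the point of the leaf lying over the image of [y]. It depends
    continuously on [y], and openly, because the lift to the plane of a
    parametrization of [X] is open. *)
Lemma integral_orbit_map (X : topologicalType) (i : X -> mcar N) :
  integral_manifold i k F -> range i = mproj N @` parallel_affine V o ->
  exists2 q : pt E' -> X, orbit_map G' q & i \o q = mproj N \o @sub_incl R E V o.
Proof.
move=> iI; rewrite -range_sub_incl image_comp => ri.
have /choice[q iqy] : forall y : pt E', exists a, i a = mproj N (sub_incl y).
  move=> y; have [a _ ay] : range i (mproj N (sub_incl y)) by rewrite ri; exists y.
  by exists a.
have ii := iI.1.
exists q; last exact/funext.
(* A parametrization of [X] at [q y], lifted to [E] and moved by [g] into the
   plane: [q] is its inverse. *)
have chart (y : pt E') : exists W phi psi w0 e g,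
    [/\ @local_param R E N X i k W phi psi, ball w0 e `<=` W, 0 < e,
        phi w0 = q y /\ elts G g & g (psi w0) = sub_incl y /\
        forall w, ball w0 e w ->
          vsub (psi w) (psi w0) \in V /\
          forall z : pt E', sub_incl z = g (psi w) -> q z = phi w].
  have [W [phi [psi [w0 [e [lp bW w0y e0 hV]]]]]] := integral_chart_in_plane iI (q y).
  have [_ _ _ _ lift] := lp.
  have /pr_fiber[g Gg gy] : mproj N (psi w0) = mproj N (sub_incl y).
    by rewrite -lift ?w0y//; apply: bW; exact: ballxx.
  exists W, phi, psi, w0, e, g; split=> //; split=> // w wb; split; first exact: hV.
  by move=> z zE; apply: ii; rewrite iqy zE pr_elts// lift//; exact: bW.
split.
- move=> y z; rewrite -restriction_fiber -pr_fiber -!iqy.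
  by split=> [->//|/ii].
- move=> a; have : range i (i a) by exists a.
  by rewrite ri => -[y _ /= ya]; exists y; apply: ii; rewrite iqy.
- move=> y A nA.
  have [W [phi [psi [w0 [e [g [lp bW e0 [w0y Gg] [gy hw]]]]]]]] := chart y.
  have [oW [_ cphi _] sm inj _] := lp.
  have w0b : ball w0 e w0 by exact: ballxx.
  have Ww0 := bW _ w0b.
  have nb : nbhs w0 (ball w0 e) by exact: nbhsx_ballx.
  have nV : \forall w \near w0, vsub (psi w) (psi w0) \in V.
    by apply: filterS nb => w /hw[].
  have nB : nbhs w0 (ball w0 e `&` (phi @^-1` A)).
    by apply: filterI => //; apply: (cphi _ Ww0); rewrite w0y.
  have [d d0 hd] := immersion_plane_open oW sm Ww0 (inj _ Ww0) nV nB.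
  apply/nbhs_ptP; exists d => // z yz.
  have [h Gh [gh hg]] := eltsV Gg.
  have psi0 : psi w0 = h (sub_incl y) by rewrite -gy gh.
  have [||w [wb Aw] wz] := hd (h (sub_incl z)).
  + by rewrite psi0; apply: pV => //; exact: sub_incl_vsub.
  + by rewrite psi0 (isometry_edist _ _ (elts_iso Gh)).
  by rewrite /= ((hw w wb).2 z)// wz hg.
move=> U oU; rewrite openE => _ [y Uy <-].
have [W [phi [psi [w0 [e [g [lp bW e0 [w0y Gg] [gy hw]]]]]]]] := chart y.
have [_ [_ _ op] sm _ _] := lp.
have w0b : ball w0 e w0 by exact: ballxx.
have [d d0 hd] := (open_ptP U).1 oU y Uy.
have npsi : \forall w \near w0, edist (psi w0) (psi w) < d.
  exact: smooth_map_near sm (bW _ w0b) d0.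
have : \forall w \near w0, ball w0 e w /\ edist (psi w0) (psi w) < d.
  by apply: filterI => //; exact: nbhsx_ballx.
move=> /nbhs_ballP[r /= r0 hr].
rewrite /interior /= -w0y.
have : nbhs (phi w0) (phi @` ball w0 r).
  apply: open_nbhs_nbhs; split; last by exists w0 => //; exact: ballxx.
  by apply: op; [move=> w /hr[/bW] | exact: ball_open].
apply: filterS => _ [w /hr[wb wd] <-].
have [wV hq] := hw w wb.
have gV : vsub (g (psi w)) o \in V.
  rewrite -(vsubD o (sub_incl y)) rpredD ?sub_inclP// -gy.
  exact: pV.
exists (sub_lift gV); last exact: hq.
apply: hd; rewrite -edist_sub sub_liftK -gy.
by rewrite (isometry_edist _ _ (elts_iso Gg)).
Qed.

End Plane.

Lemma leaf_range (X : topologicalType) (i : X -> mcar N) : leaf k F i ->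
  exists x, range i = mproj N @` parallel_affine V x.
Proof.
move=> [iI cX [a _] max].
have [x xa] := orbit_map_surj (model_orbit mN) (i a).
exists x; have [Y [j [[jI cY _ _] jr]]] := plane_leaf x.
rewrite -jr; apply/esym/max => // _ [b _ <-].
by rewrite jr -plane_class_mproj xa; exact: connected_integral_in_plane.
Qed.

Lemma leaves_plane_distribution :
  leaves k F = [set mproj N @` parallel_affine V x | x in [set: pt E]].
Proof.
apply/seteqP; split=> [S [X [i [il <-]]]|_ [x _ <-]].
  by have [x ->] := leaf_range il; exists x.
have [X [i [il ri]]] := plane_leaf x.
by exists X, i.
Qed.

Lemma plane_foliation : foliation k F.
Proof.
split=> [|p]; first exact: plane_distribution_smooth.
have [x xp] := orbit_map_surj (model_orbit mN) p.
have [X [i [[iI _ _ _] ri]]] := plane_leaf x.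
exists X, i; split=> //; rewrite ri -xp; exists x => //.
by apply/parallel_affineP; rewrite vsubxx mem0v.
Qed.

Lemma leaf_compact_geodesic (X : topologicalType) (i : X -> mcar N) :
  lattice_subspace G V -> leaf k F i ->
  compact [set: X] /\ totally_geodesic i k.
Proof.
move=> LV il; have [iI _ _ _] := il; have [x ri] := leaf_range il.
have [q qP iq] := integral_orbit_map iI ri.
split; last exact: integral_totally_geodesic.
by apply: (plane_compact qP); exact: restriction_cocompact.
Qed.

End Leaves.

(** * The models and the theorem *)

Section Models.
Context {R : realType} {E : euclideanSpace R}.
Implicit Types (G : isoGroup E) (V : {vspace dir E}).

Definition trivial_group : isoGroup E.
Proof.
refine (@IsoGroup R E [set id] _ _ _ _).
- by move=> _ ->; split=> //; exists id.
- by [].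
- by move=> _ _ -> ->.
- by move=> _ ->; exists id.
Defined.

Lemma trivial_deck_like : deck_like trivial_group.
Proof. by move=> x; exists 1. Qed.

Lemma trivial_preserves V : preserves_direction trivial_group V.
Proof. by move=> _ x y ->. Qed.

Lemma euclid_model : quotient_model trivial_group (euclid_mfd E).
Proof.
split=> [|x v y w].
  split.
  - by move=> x y /=; split=> [->|[_ -> //]]; exists id.
  - by move=> x; exists x.
  - by move=> x A.
  - by move=> U oU; rewrite /= image_id.
split=> [[-> ->]|[_ -> /= [-> /tr_inj ->]]//].
by exists id.
Qed.

Lemma quotient_mfd_model G : quotient_model G (quotient_mfd G).
Proof. by split; [exact: orbit_proj_orbit_map | exact: tangent_projP]. Qed.

Lemma plane_projectable G (N : flatManifold E) V :
  quotient_model G N -> deck_like G -> preserves_direction G V ->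
  projectable_mproj (@plane_distribution R E (euclid_mfd E) V)
                    (@plane_distribution R E N V).
Proof.
move=> mN dG pV x; rewrite (plane_distributionE mN pV).
rewrite -[x]/(mproj (euclid_mfd E) x).
rewrite (plane_distributionE euclid_model (@trivial_preserves V)).
by rewrite image_comp.
Qed.

Lemma euclid_leaves V :
  leaves (\dim V) (@plane_distribution R E (euclid_mfd E) V) =
  [set parallel_affine V x | x in [set: pt E]].
Proof.
rewrite (leaves_plane_distribution euclid_model trivial_deck_like
  (@trivial_preserves V)).
by congr image; apply/funext => x; rewrite /= image_id.
Qed.

Lemma leaves_image G (N : flatManifold E) V :
  quotient_model G N -> deck_like G -> preserves_direction G V ->
  leaves (\dim V) (@plane_distribution R E N V) =
  [set mproj N @` S | S in
    leaves (\dim V) (@plane_distribution R E (euclid_mfd E) V)].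
Proof.
move=> mN dG pV.
by rewrite (leaves_plane_distribution mN dG pV) euclid_leaves image_comp.
Qed.

End Models.

Theorem theorem1 (R : realType) (E : euclideanSpace R) (Pi : isoGroup E)
    (V' : {vspace dir E}) :
  bieberbach Pi ->
  V' != 0%VS -> V' != fullv ->
  holonomy_invariant Pi V' -> lattice_subspace Pi V' ->
  let k : nat := \dim V' in
  let L := translation_subgroup Pi in
  let M := quotient_mfd Pi in
  let T := quotient_mfd L in
  exists (F_E : distribution (euclid_mfd E)) (F_M : distribution M)
         (F_T : distribution T),
  [/\ (* (i) *)
      [/\ foliation k F_E,
          leaves k F_E = [set parallel_affine V' x | x in [set: pt E]],
          [/\ covering (mproj M), foliation k F_M, projectable_mproj F_E F_M,
              parallel_distribution F_M &
              forall (X : topologicalType) (i : X -> mcar M), leaf k F_M i ->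
                compact [set: X] /\ totally_geodesic i k] &
          [/\ covering (mproj T), foliation k F_T, projectable_mproj F_E F_T,
              parallel_distribution F_T &
              forall (X : topologicalType) (i : X -> mcar T), leaf k F_T i ->
                compact [set: X] /\ totally_geodesic i k]],
      (* (ii), the leaves of F_T *)
      leaves k F_T = [set mproj T @` S | S in leaves k F_E] /\
      (forall (X : topologicalType) (i : X -> mcar T) (x : pt E),
        leaf k F_T i -> range i = mproj T @` parallel_affine V' x ->
        exists q : pt (affine_subspace V' x) -> X,
          i \o q = mproj T \o @sub_incl R E V' x /\ riemannian_covering i q),
      (* (ii), the leaves of F_M *)
      leaves k F_M = [set mproj M @` S | S in leaves k F_E] &
      forall (X : topologicalType) (i : X -> mcar M) (x : pt E),
        leaf k F_M i -> range i = mproj M @` parallel_affine V' x ->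
        let E' := affine_subspace V' x in
        let Sigma' := setwise_stabilizer Pi (parallel_affine V' x) in
        exists (q : pt E' -> X) (Pi' : isoGroup E'),
        [/\ i \o q = mproj M \o @sub_incl R E V' x /\ riemannian_covering i q,
            [/\ elts Pi' = deck q, bieberbach Pi' &
                exists2 h : orbit_space Pi' -> X,
                  homeomorphism h & h \o orbit_proj Pi' = q],
            (* (a) *)
            elts Pi' = [set f | exists2 g, elts Sigma' g & restricts_to g f],
            [/\ (* (b) *)
                holonomy Pi' =
                  [set B | exists2 A, holonomy Sigma' A &
                                      linear_restricts_to A B],
                (* (c) *)
                lattice Pi' = [set v | elts Pi' (tr^~ v)] &
                [set v : dir E' | lattice Pi (vsval (v : subvs_of V'))]
                  `<=` lattice Pi'] &
            (* (iii) *)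
            exists rho : (pt E -> pt E) -> (pt E' -> pt E'),
              [/\ forall g, elts Sigma' g -> restricts_to g (rho g),
                  forall g h, elts Sigma' g -> elts Sigma' h ->
                    rho (g \o h) = rho g \o rho h &
                  set_bij (elts Sigma') (elts Pi') rho]]].
Proof.
move=> [tPi dPi _] _ _ hV LV k L M T.
have dM : deck_like Pi := torsion_free_discrete_deck_like tPi dPi.
have pM : preserves_direction Pi V' := holonomy_invariant_preserves hV.
have dT : deck_like L.
  by move=> x; have [e e0 he] := dM x; exists e => // g [Pg _]; exact: he.
have pT : preserves_direction L V' by move=> g x y [Pg _]; exact: pM.
have LT : lattice_subspace L V'.
  case: LV => s sL sV; exists s => // v /sL[Lv vV]; split=> //; split=> //.
  by exists v.
have mM := quotient_mfd_model Pi; have mT := quotient_mfd_model L.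
exists (@plane_distribution R E (euclid_mfd E) V'),
  (@plane_distribution R E M V'), (@plane_distribution R E T V'); split.
- split.
  + exact: plane_foliation euclid_model trivial_deck_like (@trivial_preserves _ _ V').
  + exact: euclid_leaves.
  + split.
    * exact: orbit_map_covering dM _ _ (model_orbit mM).
    * exact: plane_foliation mM dM pM.
    * exact: plane_projectable mM dM pM.
    * exact: plane_distribution_parallel mM dM pM.
    * by move=> X i; exact: leaf_compact_geodesic mM dM pM X i LV.
  + split.
    * exact: orbit_map_covering dT _ _ (model_orbit mT).
    * exact: plane_foliation mT dT pT.
    * exact: plane_projectable mT dT pT.
    * exact: plane_distribution_parallel mT dT pT.
    * by move=> X i; exact: leaf_compact_geodesic mT dT pT X i LT.
- split; first exact: leaves_image mT dT pT.
  move=> X i x [iI _ _ _] ri.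
  have [q qP iq] := integral_orbit_map mT dT pT iI ri.
  by exists q; split=> //; exact: (plane_riemannian_covering dT qP iq).
- exact: leaves_image mM dM pM.
move=> X i x [iI _ _ _] ri E' Sigma'.
have [q qP iq] := integral_orbit_map mM dM pM iI ri.
have dPi' := restriction_deck_like (o := x) pM dM.
exists q, (restriction_group x pM); split.
- by split=> //; exact: (plane_riemannian_covering dM qP iq).
- split; [exact: orbit_map_deck | split | exact: orbit_map_homeo].
  + exact: restriction_torsion_free.
  + exact: deck_like_discrete.
  + exact: restriction_cocompact.
- by [].
- by split; [exact: holonomy_restriction | | exact: lattice_restriction].
- exact: restriction_iso.
Qed.
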